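(* Let $(M,J,g)$ be a conformal Kähler manifold with Norden metric of dimension $2n$, let $\lambda_1,\lambda_2,\lambda_3,\lambda_4\in\mathbb{R}$, and let $\nabla'$ be the complex connection $$\nabla'_xy=\nabla_xy+\tfrac{1}{2n}\left[\theta(Jy)x-g(x,y)J\Omega\right]+\tfrac1n\left\{\lambda_1\theta(x)y+\lambda_2\theta(x)Jy+\lambda_3\theta(Jx)y+\lambda_4\theta(Jx)Jy\right\}.$$ Then the $(0,4)$ curvature tensor $R'$ of $\nabla'$ is conformally invariant under the transformation $\overline g=e^{2u}g$ with $u$ pluriharmonic, i.e. $\overline R'=e^{2u}R'$, where $\overline R'$ is the $(0,4)$ curvature tensor of the connection $\overline\nabla'$ constructed in the same way (with the same $\lambda_i$) from $(M,J,\overline g)$.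
   Context: An almost complex manifold with Norden metric $(M,J,g)$ is a smooth $2n$-dimensional manifold with an almost complex structure $J$ ($J^2=-\mathrm{id}$) and a pseudo-Riemannian metric $g$ with $g(Jx,Jy)=-g(x,y)$. Let $\nabla$ be the Levi-Civita connection of $g$ and $F(x,y,z)=g((\nabla_xJ)y,z)$. The Lie 1-forms are $\theta(x)=g^{ij}F(e_i,e_j,x)$ (for any local basis $\{e_i\}$, $(g^{ij})$ the inverse matrix of $g$) and $\theta^*=\theta\circ J$; the Lie vector $\Omega$ is defined by $\theta(x)=g(x,\Omega)$. $(M,J,g)$ is a $\mathcal{W}_1$-manifold if $$F(x,y,z)=\tfrac{1}{2n}\left[g(x,y)\theta(z)+g(x,Jy)\theta(Jz)+g(x,z)\theta(y)+g(x,Jz)\theta(Jy)\right].$$ A conformal Kähler manifold with Norden metric is a $\mathcal{W}_1$-manifold with $d\theta=d\theta^*=0$. A connection $D$ is complex if $DJ=0$. For a connection $D$, $R^D(x,y)z=D_xD_yz-D_yD_xz-D_{[x,y]}z$. A smooth function $u$ is pluriharmonic if $du\circ J$ is closed. Bars denote objects constructed by the same definitions from $\overline g$ in place of $g$ (Levi-Civita connection $\overline\nabla$, Lie 1-form $\overline\theta$, Lie vector $\overline\Omega$, connection $\overline\nabla'$). The $(0,4)$ tensors are $R'(x,y,z,w)=g(R'(x,y)z,w)$ and $\overline R'(x,y,z,w)=\overline g(\overline R'(x,y)z,w)$. *)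

(* Defs.v *)
From mathcomp Require Import all_boot all_order all_algebra.
From mathcomp Require Import all_classical all_reals all_analysis.
Set Implicit Arguments.
Unset Strict Implicit.
Unset Printing Implicit Defensive.
Import Order.TTheory GRing.Theory Num.Theory.
Import numFieldNormedType.Exports.
Local Open Scope classical_set_scope.
Local Open Scope ring_scope.

Section SmoothMaps.
Variables (R : realType) (E F : normedModType R).

(* f is C^k on U; only meant for U open. *)
Fixpoint Ck (k : nat) (U : set E) (f : E -> F) : Prop :=
  match k with
  | 0%N => forall x, U x -> {for x, continuous f}
  | k'.+1 => (forall x, U x -> differentiable f x) /\
             (forall v : E, Ck k' U ('D_v f))
  end.

Definition Cinfty (U : set E) (f : E -> F) : Prop := forall k, Ck k U f.

End SmoothMaps.

(* Smooth m-manifolds, presented by an atlas. The total functions [coord i] and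
   [param i] are mutually inverse homeomorphisms between [dom i] and
   [coord i @` dom i]; their values elsewhere are irrelevant. The chart
   [chart_at p] around p serves as the reference in which tangent vectors at p
   are written. *)
Record manifold (R : realType) (m : nat) := Manifold {
  carrier :> topologicalType;
  idx : Type;
  dom : idx -> set carrier;
  coord : idx -> carrier -> 'rV[R]_m;
  param : idx -> 'rV[R]_m -> carrier;
  chart_at : carrier -> idx;
  manifold_hausdorff : hausdorff_space carrier;
  manifold_second_countable : @second_countable carrier;
  dom_open : forall i, open (dom i);
  codom_open : forall i, open (coord i @` dom i);
  coordK : forall i p, dom i p -> param i (coord i p) = p;
  coord_continuous : forall i p, dom i p -> {for p, continuous (coord i)};
  param_continuous : forall i p, dom i p ->
    {for coord i p, continuous (param i)};
  transition_smooth : forall i j,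
    Cinfty (coord i @` (dom i `&` dom j)) (coord j \o param i);
  mem_chart_at : forall p, dom (chart_at p) p
}.

Section Calculus.
Variables (R : realType) (m : nat) (M : manifold R m).

(* T_p M is identified with R^m through the chart [chart_at p]: a tangent vector
   at p is its row of components in that chart. Hence a not necessarily smooth
   vector field is a function M -> 'rV_m, and a tensor field with values in
   bilinear forms or endomorphisms is a function M -> 'M_m. *)
Definition vfield := M -> 'rV[R]_m.
Definition form1 := M -> 'rV[R]_m -> R.
Definition tensor2 := M -> 'M[R]_m.

(* A(x, y) for a Gram matrix A. *)
Definition bil (A : 'M[R]_m) (x y : 'rV[R]_m) : R := (x *m A *m y^T) 0 0.

Definition applyf (J : tensor2) (X : vfield) : vfield := fun p => X p *m J p.

Definition smooth_on (U : set M) (f : M -> R) : Prop :=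
  forall i : idx M, Cinfty (coord i @` (U `&` dom i)) (f \o param i).

(* The components in the chart i of a vector field, obtained from the components
   in [chart_at q] by the Jacobian of the change of charts at q. *)
Definition vcomp (i : idx M) (X : vfield) : vfield := fun q =>
  'D_(X q) (coord i \o param (chart_at q)) (coord (chart_at q) q).

Definition vsmooth_on (U : set M) (X : vfield) : Prop :=
  forall i : idx M, Cinfty (coord i @` (U `&` dom i)) (vcomp i X \o param i).

Definition smooth_near (p : M) (f : M -> R) : Prop :=
  exists U : set M, [/\ open U, U p & smooth_on U f].

Definition vsmooth_near (p : M) (X : vfield) : Prop :=
  exists U : set M, [/\ open U, U p & vsmooth_on U X].

(* df_p(x) *)
Definition dfun (f : M -> R) : form1 := fun p x =>
  'D_x (f \o param (chart_at p)) (coord (chart_at p) p).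

(* [X, Y]^k = X^i d_i Y^k - Y^i d_i X^k, computed at p in the chart at p. *)
Definition bracket (X Y : vfield) : vfield := fun p =>
  let c := chart_at p in
  'D_(X p) (vcomp c Y \o param c) (coord c p)
  - 'D_(Y p) (vcomp c X \o param c) (coord c p).

Definition dform (w : form1) (p : M) (X Y : vfield) : R :=
  dfun (fun q => w q (Y q)) p (X p) - dfun (fun q => w q (X q)) p (Y p)
  - w p (bracket X Y p).

Definition closed_form (w : form1) : Prop :=
  forall p X Y, vsmooth_near p X -> vsmooth_near p Y -> dform w p X Y = 0.

(* w o J *)
Definition form_comp (w : form1) (J : tensor2) : form1 :=
  fun p x => w p (x *m J p).

Definition pluriharmonic (J : tensor2) (u : M -> R) : Prop :=
  smooth_on setT u /\ closed_form (form_comp (dfun u) J).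

(* [D p x Y] is (D_x Y)(p) for x in T_p M. Only the values on fields that are
   smooth on a neighbourhood of p are constrained; the Leibniz rule with f the
   indicator of an open set shows that they depend only on the germ of Y at p, so
   this is the usual action of a linear connection on local smooth vector
   fields. *)
Definition covder := forall p : M, 'rV[R]_m -> vfield -> 'rV[R]_m.

Record is_connection (D : covder) : Prop := IsConnection {
  conn_linear : forall p Y, vsmooth_near p Y ->
    forall (a : R) x x', D p (a *: x + x') Y = a *: D p x Y + D p x' Y;
  conn_add : forall p x Y Z, vsmooth_near p Y -> vsmooth_near p Z ->
    D p x (fun q => Y q + Z q) = D p x Y + D p x Z;
  conn_leibniz : forall p x f Y, smooth_near p f -> vsmooth_near p Y ->
    D p x (fun q => f q *: Y q) = dfun f p x *: Y p + f p *: D p x Y;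
  conn_smooth : forall p X Y, vsmooth_near p X -> vsmooth_near p Y ->
    vsmooth_near p (fun q => D q (X q) Y)
}.

Record levi_civita (g : tensor2) (D : covder) : Prop := LeviCivita {
  lc_connection : is_connection D;
  lc_torsion : forall p X Y, vsmooth_near p X -> vsmooth_near p Y ->
    D p (X p) Y - D p (Y p) X = bracket X Y p;
  lc_metric : forall p x Y Z, vsmooth_near p Y -> vsmooth_near p Z ->
    dfun (fun q => bil (g q) (Y q) (Z q)) p x
    = bil (g p) (D p x Y) (Z p) + bil (g p) (Y p) (D p x Z)
}.

(* R^D(X, Y)Z at p *)
Definition curvature (D : covder) (p : M) (X Y Z : vfield) : 'rV[R]_m :=
  D p (X p) (fun q => D q (Y q) Z) - D p (Y p) (fun q => D q (X q) Z)
  - D p (bracket X Y p) Z.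

Definition curvature4 (g : tensor2) (D : covder) (p : M) (X Y Z W : vfield) : R :=
  bil (g p) (curvature D p X Y Z) (W p).

Record pseudo_riemannian (g : tensor2) : Prop := PseudoRiemannian {
  metric_smooth : forall p X Y, vsmooth_near p X -> vsmooth_near p Y ->
    smooth_near p (fun q => bil (g q) (X q) (Y q));
  metric_sym : forall p x y, bil (g p) x y = bil (g p) y x;
  metric_nondegenerate : forall p, g p \in unitmx
}.

Record almost_complex (J : tensor2) : Prop := AlmostComplex {
  acs_smooth : forall p X, vsmooth_near p X -> vsmooth_near p (applyf J X);
  acs_sqr : forall p (x : 'rV[R]_m), x *m J p *m J p = - x
}.

Record norden (J g : tensor2) : Prop := Norden {
  norden_acs : almost_complex J;
  norden_metric : pseudo_riemannian g;
  norden_anti : forall p (x y : 'rV[R]_m),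
    bil (g p) (x *m J p) (y *m J p) = - bil (g p) x y
}.

Definition conformal (u : M -> R) (g : tensor2) : tensor2 :=
  fun p => expR (2 * u p) *: g p.

(* F(x, Y, z) = g((D_x J)Y, z) at p, with (D_x J)Y = D_x(JY) - J(D_x Y). *)
Definition Ftensor (J g : tensor2) (D : covder) (p : M)
    (x : 'rV[R]_m) (Y : vfield) (z : 'rV[R]_m) : R :=
  bil (g p) (D p x (applyf J Y) - D p x Y *m J p) z.

Definition local_frame (p : M) (e : 'I_m -> vfield) : Prop :=
  (forall i, vsmooth_near p (e i)) /\ \matrix_i (e i p) \in unitmx.

Definition lie_form (J g : tensor2) (D : covder) (theta : form1) : Prop :=
  forall p (e : 'I_m -> vfield), local_frame p e -> forall z,
    theta p z =
      \sum_(i < m) \sum_(j < m)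
        invmx (\matrix_(k < m, l < m) bil (g p) (e k p) (e l p)) i j
        * Ftensor J g D p (e i p) (e j) z.

Definition lie_vector (g : tensor2) (theta : form1) (Omega : vfield) : Prop :=
  forall p x, theta p x = bil (g p) x (Omega p).

End Calculus.

Section ConformalKaehler.
Variables (R : realType) (n : nat) (M : manifold R n.*2).

Definition W1 (J g : tensor2 M) (D : covder M) (theta : form1 M) : Prop :=
  forall p x (Y : vfield M) z, vsmooth_near p Y ->
    let G := bil (g p) in
    let t := theta p in
    let Jp v := v *m J p in
    let y := Y p in
    Ftensor J g D p x Y z =
      (2 * n%:R)^-1 * (G x y * t z + G x (Jp y) * t (Jp z)
                       + G x z * t y + G x (Jp z) * t (Jp y)).

Definition conformal_kaehler (J g : tensor2 M) (D : covder M)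
    (theta : form1 M) : Prop :=
  [/\ W1 J g D theta, closed_form theta & closed_form (form_comp theta J)].

Definition nabla' (J g : tensor2 M) (D : covder M) (theta : form1 M)
    (Omega : vfield M) (l1 l2 l3 l4 : R) : covder M :=
  fun p x Y =>
    let Jp v := v *m J p in
    let t := theta p in
    let y := Y p in
    D p x Y
    + (2 * n%:R)^-1 *: (t (Jp y) *: x - bil (g p) x y *: Jp (Omega p))
    + n%:R^-1 *: ((l1 * t x) *: y + (l2 * t x) *: Jp y
                  + (l3 * t (Jp x)) *: y + (l4 * t (Jp x)) *: Jp y).

End ConformalKaehler.

(* Main.v *)
(** Write [gbar = e^(2u) g]. The Koszul uniqueness argument gives
    [Dbar_x y = D_x y + du(x) y + du(y) x - g(x,y) grad u]. Since [tr J = 0], contracting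
    the resulting change of [F] gives [thetabar = theta + 2n (du o J)], hence
    [Omegabar = e^(-2u) (Omega + 2n J grad u)]. In [nabla'] all terms that are not
    pointwise multiples of [y] and [J y] then cancel, and
      [nablabar'_x y = nabla'_x y + a(x) y + b(x) J y],
      [a = (1 - 2 l3) du + 2 l1 (du o J)],  [b = - 2 l4 du + 2 l2 (du o J)].
    The W1 condition says exactly that [nabla' J = 0], so [1] and [J] are parallel and
    commute, and the curvature changes by [da * 1 + db * J], which vanishes because [u]
    is pluriharmonic. *)

Require Import Defs.
From HB Require Import structures.
From mathcomp Require Import all_boot all_order all_algebra.
From mathcomp Require Import all_classical all_reals all_analysis.
From mathcomp Require Import ring lra.
Import numFieldNormedType.Exports.
Import Order.TTheory GRing.Theory Num.Theory.
Set Implicit Arguments.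
Unset Strict Implicit.
Unset Printing Implicit Defensive.
Local Open Scope classical_set_scope.
Local Open Scope ring_scope.

(* [coord] alone now denotes coordinates in a basis of a vector space. *)
Local Notation coord := Defs.coord.

(** * C^k maps between normed spaces *)

(** Two obstacles shape the proof. First, a connection is constrained only on fields smooth near the
    point, while [theta] and [Omega] are specified pointwise. Expanding a curvature differentiates
    inner fields such as [q => D q (Y q) Z], so each of them has to be shown smooth beforehand;
    hence the C^k calculus, the coordinate frames and the smooth inverse Gram matrix. Second, the
    components of a tangent vector at [q] refer to the chart [chart_at q], which may jump with [q].
    Anything to be differentiated is therefore first rewritten in one fixed chart; in that form the
    identity d(du) = 0 becomes the symmetry of second derivatives of a real function on R^m. The
    curvature comparison itself is isolated as a statement about two connections that differ by a
    1-form with values in the commutative algebra spanned by 1 and J. *)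

Section CkTheory.
Variables (R : realType) (E F : normedModType R).
Implicit Types (U V : set E) (f g : E -> F).

(** The first-order expansion of [f] at [x] is also one for [g], and uniqueness of the differential
    identifies it with ['d g x]. *)
Lemma near_eq_differentiable f g (x : E) :
  {near x, f =1 g} -> differentiable f x -> differentiable g x.
Proof.
move=> fg df; have fgx : f x = g x by exact: nbhs_singleton fg.
have gE : (g \o shift x = cst (g x) + 'd f x +o_ 0 id).
  apply/eqaddoP => e e0.
  have /eqaddoP/(_ _ e0) := diff_locally df.
  have : \forall h \near (0 : E), f (h + x) = g (h + x).
    by have := fg; rewrite [X in X -> _](near_shift (0 : E) x) /= subr0.
  apply: filter_app2; near=> h => fgh.
  by rewrite !fctE /= fgx /shift /= fgh.
have dg : 'd g x = 'd f x :> (E -> F).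
  by apply: diff_unique => //; exact: diff_continuous.
by apply/diff_locallyP; rewrite dg; split => //; exact: diff_continuous.
Unshelve. all: by end_near. Qed.

Lemma near_eq_continuous f g (x : E) :
  {near x, f =1 g} -> {for x, continuous f} -> {for x, continuous g}.
Proof.
move=> fg fc; rewrite /prop_for /continuous_at -(nbhs_singleton fg).
apply: cvg_trans fc; apply: near_eq_cvg.
by apply: filterS fg => y ->.
Qed.

(** Openness turns equality on [U] into equality near each of its points, which is what derivatives
    see. The values of the total functions outside [U] thereby become irrelevant. *)
Lemma Ck_eq k U f g : open U -> (forall x, U x -> f x = g x) ->
  Ck k U f -> Ck k U g.
Proof.
move=> oU; elim: k f g => [|k IH] f g fg.
  move=> fc x Ux; apply: near_eq_continuous (fc x Ux).
  by apply: filterS (open_nbhs_nbhs (conj oU Ux)).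
move=> [df Df]; have fgn x : U x -> {near x, f =1 g}.
  by move=> Ux; apply: filterS (open_nbhs_nbhs (conj oU Ux)).
split=> [x Ux|v]; first exact: near_eq_differentiable (fgn x Ux) (df x Ux).
by apply: IH (Df v) => x Ux; exact: near_eq_derive (fgn x Ux).
Qed.

Lemma Ck_subset k U V f : V `<=` U -> Ck k U f -> Ck k V f.
Proof.
move=> VU; elim: k f => [|k IH] f /=; first by move=> fc x /VU; exact: fc.
by move=> [df Df]; split => [x /VU|v]; [exact: df|exact: IH].
Qed.

Lemma CkW k U f : Ck k.+1 U f -> Ck k U f.
Proof.
elim: k f => [|k IH] f [df Df].
  by move=> x /df; exact: differentiable_continuous.
by split=> // v; exact: IH.
Qed.

Lemma Ck_cst k U (c : F) : Ck k U (fun=> c).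
Proof.
elim: k c => [|k IH] c; first by move=> x _; exact: cst_continuous.
split=> [x _|v]; first exact: differentiable_cst.
suff -> : 'D_v (fun=> c : F) = (fun=> 0) :> (E -> F) by exact: IH.
by apply/funext => x; rewrite derive_cst.
Qed.

Lemma Ck_add k U f g : open U -> Ck k U f -> Ck k U g ->
  Ck k U (fun x => f x + g x).
Proof.
move=> oU; elim: k f g => [|k IH] f g.
  by move=> fc gc x Ux; apply: continuousD; [exact: fc|exact: gc].
move=> [df Df] [dg Dg]; split=> [x Ux|v].
  by apply: differentiableD; [exact: df|exact: dg].
apply: Ck_eq oU _ (IH _ _ (Df v) (Dg v)) => x Ux.
by rewrite -deriveD //; apply: diff_derivable; [exact: df|exact: dg].
Qed.

Lemma Ck_sum (I : Type) (r : seq I) (P : pred I) k U (f : I -> E -> F) :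
  open U -> (forall i, P i -> Ck k U (f i)) ->
  Ck k U (fun x => \sum_(i <- r | P i) f i x).
Proof.
move=> oU fC; elim: r => [|i r IH].
  by apply: Ck_eq oU _ (Ck_cst k U 0) => x _; rewrite big_nil.
have [Pi|Pi] := boolP (P i).
  by apply: Ck_eq oU _ (Ck_add oU (fC i Pi) IH) => x _; rewrite big_cons Pi.
by apply: Ck_eq oU _ IH => x _; rewrite big_cons (negbTE Pi).
Qed.

Lemma Cinfty_derive U f v : Cinfty U f -> Cinfty U ('D_v f).
Proof. by move=> fC k; have [_] := fC k.+1; apply. Qed.

Lemma Cinfty_differentiable U f x : Cinfty U f -> U x -> differentiable f x.
Proof. by move=> fC; have [+ _] := fC 1%N; apply. Qed.

End CkTheory.

Lemma Ck_lin (R : realType) (E F G : normedModType R) k (U : set E)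
    (f : E -> F) (L : {linear F -> G}) : open U -> continuous L ->
  Ck k U f -> Ck k U (L \o f).
Proof.
move=> oU Lc; elim: k f => [|k IH] f.
  by move=> fc x Ux; apply: continuous_comp; [exact: fc|exact: Lc].
have Ld y : differentiable L y by exact: linear_differentiable.
move=> [df Df]; split=> [x Ux|v].
  by apply: differentiable_comp; [exact: df|exact: Ld].
apply: Ck_eq oU _ (IH _ (Df v)) => x Ux /=.
rewrite [RHS]deriveE; last by apply: differentiable_comp; [exact: df|].
by rewrite diff_comp //= ?diff_lin ?deriveE //; exact: df.
Qed.

Lemma derive_comp (R : realType) (E F G : normedModType R) (f : F -> G)
    (h : E -> F) x v :
  differentiable h x -> differentiable f (h x) ->
  'D_v (f \o h) x = 'D_('D_v h x) f (h x).
Proof.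
move=> dh df; rewrite deriveE; last exact: differentiable_comp.
by rewrite diff_comp //= !deriveE.
Qed.

Section CkScalar.
Variables (R : realType) (E : normedModType R).
Implicit Types (U : set E) (f g : E -> R).

Lemma Ck_mul k U f g : open U -> Ck k U f -> Ck k U g ->
  Ck k U (fun x => f x * g x).
Proof.
move=> oU; elim: k f g => [|k IH] f g.
  by move=> fc gc x Ux; apply: continuousM; [exact: fc|exact: gc].
move=> fC gC; have [df Df] := fC; have [dg Dg] := gC; split=> [x Ux|v].
  by apply: differentiableM; [exact: df|exact: dg].
have fgD := Ck_add oU (IH _ _ (CkW fC) (Dg v)) (IH _ _ (CkW gC) (Df v)).
apply: Ck_eq oU _ fgD => x Ux.
by rewrite -deriveM //; apply: diff_derivable; [exact: df|exact: dg].
Qed.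

Lemma Ck_inv k U f : open U -> (forall x, U x -> f x != 0) ->
  Ck k U f -> Ck k U (fun x => (f x)^-1).
Proof.
move=> oU f0; elim: k => [|k IH] fC.
  by move=> x Ux; apply: continuousV; [exact: f0|exact: fC].
have [df Df] := fC; split=> [x Ux|v].
  by apply: differentiableV; [exact: df|exact: f0].
have fI := IH (CkW fC).
have fD := Ck_mul oU (Ck_cst k U (-1 : R)) (Ck_mul oU (Ck_mul oU fI fI) (Df v)).
apply: Ck_eq oU _ fD => x Ux.
rewrite deriveV ?f0 //; last by apply: diff_derivable; exact: df.
by rewrite mulN1r -invfM expr2 scaleNr.
Qed.

Lemma Cinfty_add U f g : open U -> Cinfty U f -> Cinfty U g ->
  Cinfty U (fun x => f x + g x).
Proof. by move=> oU fC gC k; exact: Ck_add. Qed.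

Lemma Cinfty_mul U f g : open U -> Cinfty U f -> Cinfty U g ->
  Cinfty U (fun x => f x * g x).
Proof. by move=> oU fC gC k; exact: Ck_mul. Qed.

End CkScalar.

Section CkRow.
Variables (R : realType) (m : nat).

Lemma Ck_coord (E : normedModType R) k (U : set E) (f : E -> 'rV[R]_m) j :
  open U -> Ck k U f -> Ck k U (fun x => f x 0 j).
Proof.
move=> oU fC; pose c (x : 'rV[R]_m) : R := x 0 j.
have c_lin : linear c by move=> a x y; rewrite /c !mxE.
pose cM := GRing.isLinear.Build _ _ _ _ _ c_lin.
pose cL : {linear _ -> _} := HB.pack c cM.
by apply: (Ck_lin (L := cL) oU _ fC); exact: coord_continuous.
Qed.

Lemma Ck_row (E : normedModType R) (U : set E) (f : E -> 'rV[R]_m) :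
  open U -> (forall j, Cinfty U (fun x => f x 0 j)) -> Cinfty U f.
Proof.
move=> oU fC; have fS : Cinfty U (fun x => \sum_j f x 0 j *: delta_mx 0 j : 'rV[R]_m).
  move=> k; apply: (Ck_sum _ oU) => j _; pose s (a : R) : 'rV[R]_m := a *: delta_mx 0 j.
  have s_lin : linear s by move=> a b c; rewrite /s scalerDl scalerA.
  pose sM := GRing.isLinear.Build _ _ _ _ _ s_lin.
  pose sL : {linear _ -> _} := HB.pack s sM.
  by apply: (Ck_lin (L := sL) oU _ (fC j k)); exact: scalel_continuous.
by move=> k; apply: Ck_eq oU _ (fS k) => x _; rewrite -row_sum_delta.
Qed.

Lemma derive_row_sum (f : 'rV[R]_m -> R) x v : differentiable f x ->
  'D_v f x = \sum_j v 0 j * 'D_(delta_mx 0 j) f x.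
Proof.
move=> df; rewrite deriveE // {1}(row_sum_delta v) linear_sum.
by apply: eq_bigr => j _; rewrite linearZ deriveE.
Qed.

(** In the chain rule the direction ['D_v h x] varies with [x], so the induction hypothesis does not
    apply to it directly. Expanding that direction in the basis of R^m leaves products of components
    of ['D_v h] with ['D_(delta_mx 0 j) f \o h], where the directions are fixed. *)
Lemma Ck_comp (E : normedModType R) k (U : set E) (V : set 'rV[R]_m)
    (f : 'rV[R]_m -> R) (h : E -> 'rV[R]_m) :
  open U -> (forall x, U x -> V (h x)) ->
  Ck k V f -> Ck k U h -> Ck k U (f \o h).
Proof.
move=> oU UV; elim: k f => [|k IH] f.
  by move=> fc hc x Ux; apply: continuous_comp; [exact: hc|exact/fc/UV].
move=> [df Df] hC; have [dh Dh] := hC; split=> [x Ux|v].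
  by apply: differentiable_comp; [exact: dh|exact/df/UV].
have fhC : Ck k U (fun x =>
    \sum_j 'D_v h x 0 j * ('D_(delta_mx 0 j) f \o h) x).
  apply: (Ck_sum _ oU) => j _; apply: (Ck_mul oU); first exact: (Ck_coord j oU (Dh v)).
  by apply: IH; [exact: Df|exact: CkW].
apply: Ck_eq oU _ fhC => x Ux; have dfx : differentiable f (h x) by exact/df/UV.
by rewrite [RHS](derive_comp v (dh x Ux) dfx) (derive_row_sum _ dfx).
Qed.

End CkRow.

(** * Symmetry of second derivatives *)

Section Schwarz.
Variables (R : realType) (E : normedModType R).
Implicit Types (f g : E -> R) (a v w : E).

Lemma is_diff_line a v (t : R) :
  is_diff t (fun s : R => a + s *: v) (fun s : R => s *: v).
Proof.
exact: is_diff_eq (is_diffD (is_diff_cst a t) (is_diff_scalel t v)) (add0r _).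
Qed.

Lemma mean_value_line g a v (h : R) : 0 < h ->
  (forall t, 0 <= t <= h -> differentiable g (a + t *: v)) ->
  exists2 c, 0 <= c <= h &
    g (a + h *: v) - g a = h * 'D_v g (a + c *: v).
Proof.
move=> h0 dg; pose l (t : R) := a + t *: v.
have dl t : is_diff t l (fun s : R => s *: v) by exact: is_diff_line.
have dgl t : 0 <= t <= h -> is_derive t (1 : R) (g \o l) ('D_v g (l t)).
  move=> th; have dglt : differentiable (g \o l) t.
    by apply: differentiable_comp; [exact: ex_diff|exact: dg].
  apply: DeriveDef; first exact: diff_derivable.
  rewrite derive_comp; [|exact: ex_diff|exact: dg].
  by rewrite (deriveE _ (@ex_diff _ _ _ _ _ _ _ (dl t))) diff_val scale1r.
have [||c] := @MVT R (g \o l) (fun t => 'D_v g (l t)) 0 h h0.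
- by move=> t; rewrite in_itv /= => /andP[/ltW t0 /ltW th]; apply: dgl; rewrite t0.
- apply: continuous_in_subspaceT => t; rewrite inE/= in_itv /= => th.
  apply: differentiable_continuous; apply/derivable1_diffP.
  exact: (@ex_derive _ _ _ _ _ _ _ (dgl t th)).
rewrite in_itv /= subr0 => /andP[/ltW c0 /ltW ch]; rewrite /l scale0r addr0.
by rewrite mulrC => gE; exists c; rewrite ?c0.
Qed.

Lemma derive_shift_arg f (b : E) a v : differentiable f (a + b) ->
  differentiable (fun y => f (y + b)) a /\
  'D_v (fun y => f (y + b)) a = 'D_v f (a + b).
Proof.
move=> df; have db : is_diff a (fun y => y + b) id.
  exact: is_diff_eq (is_diffD (is_diff_id a) (is_diff_cst b a)) (addr0 _).
split; first exact: differentiable_comp.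
by rewrite derive_comp // (deriveE _ (@ex_diff _ _ _ _ _ _ _ db)) diff_val.
Qed.

(** Two uses of the mean value theorem: on [f (y + h *: w) - f y] along [v], then on ['D_v f] along
    [w]. The left side is symmetric in [v] and [w], which is the source of Schwarz's theorem. *)
Lemma second_difference f a v w (h : R) : 0 < h ->
  (forall s t, 0 <= s <= h -> 0 <= t <= h ->
     differentiable f (a + s *: v + t *: w) /\
     differentiable ('D_v f) (a + s *: v + t *: w)) ->
  exists c d, [/\ 0 <= c <= h, 0 <= d <= h &
    f (a + h *: v + h *: w) - f (a + h *: v) - (f (a + h *: w) - f a)
    = h * (h * 'D_w ('D_v f) (a + c *: v + d *: w))].
Proof.
move=> h0 df; pose g y := f (y + h *: w) - f y.
have hh : 0 <= h <= h by rewrite ltW /=.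
have z0 : 0 <= (0 : R) <= h by rewrite lexx ltW.
have dg t : 0 <= t <= h -> is_derive (a + t *: v) v g
    ('D_v f (a + t *: v + h *: w) - 'D_v f (a + t *: v)) /\ differentiable g (a + t *: v).
  move=> th; have [df1 _] := df t h th hh; have [df2 _] := df t 0 th z0.
  rewrite scale0r addr0 in df2; have [sd sD] := derive_shift_arg v df1.
  split; last exact: differentiableB.
  apply: is_deriveB; apply: DeriveDef; by [exact: diff_derivable|].
have [t /dg[_]//|c ch gE] := @mean_value_line g a v h h0.
have [t th|d dh fE] := @mean_value_line ('D_v f) (a + c *: v) w h h0.
  by have [] := df c t ch th.
exists c, d; split=> //; rewrite -fE.
by have [[_ <-] _] := dg _ ch; rewrite -gE.
Qed.

Lemma derive_schwarz (U : set E) f a v w : open U -> U a -> Ck 2 U f ->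
  'D_v ('D_w f) a = 'D_w ('D_v f) a.
Proof.
move=> oU Ua [df Df].
have dDf u x : U x -> differentiable ('D_u f) x by have [+ _] := Df u; apply.
have cont u u' : {for a, continuous ('D_u ('D_u' f))}.
  by have [_ /(_ u)] := Df u'; apply.
apply/eqP; rewrite -subr_eq0 -normr_le0; apply/ler_addgt0Pl => e e0; rewrite addr0.
have e2 : 0 < e / 2 by rewrite divr_gt0.
have n1 : \forall y \near a, `|'D_v ('D_w f) a - 'D_v ('D_w f) y| < e / 2.
  by have /cvgrPdist_lt := cont v w; apply.
have n2 : \forall y \near a, `|'D_w ('D_v f) a - 'D_w ('D_v f) y| < e / 2.
  by have /cvgrPdist_lt := cont w v; apply.
have nU : \forall y \near a, U y by exact: open_nbhs_nbhs.
have [r /= r0 rP] := (nbhs_ballP _ _).1 (filterI nU (filterI n1 n2)).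
(* With this step the parallelogram spanned by [h *: v] and [h *: w] at [a] stays within distance r
   / 2 of [a]; the summand 1 keeps the denominator positive when both vectors vanish. *)
pose h := r / (2 * (`|v| + `|w| + 1)).
have vw0 : 0 < `|v| + `|w| + 1 by rewrite ltr_wpDl // addr_ge0.
have h0 : 0 < h by rewrite divr_gt0 // mulr_gt0.
have inr s t : 0 <= s <= h -> 0 <= t <= h -> ball a r (a + s *: v + t *: w).
  move=> /andP[s0 sh] /andP[t0 th]; rewrite -ball_normE /= -addrA opprD addNKr normrN.
  apply: le_lt_trans (ler_normD _ _) _; rewrite !normrZ !ger0_norm //.
  apply: (@le_lt_trans _ _ (h * (`|v| + `|w| + 1))).
    have sv : s * `|v| <= h * `|v| by exact: ler_wpM2r.
    have tw : t * `|w| <= h * `|w| by exact: ler_wpM2r.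
    lra.
  have -> : h * (`|v| + `|w| + 1) = r / 2 by rewrite /h; field; rewrite gt_eqF.
  by rewrite ltr_pdivrMr // ltr_pMr // ltr1n.
have [s t sh th|c [d [ch dh E1]]] := @second_difference f a v w h h0.
  by have [/= Uy _] := rP _ (inr s t sh th); split; [exact: df|exact: dDf].
have inr' s t : 0 <= s <= h -> 0 <= t <= h -> ball a r (a + s *: w + t *: v).
  by move=> sh th; rewrite addrAC; exact: inr.
have [s t sh th|c' [d' [ch' dh' E2]]] := @second_difference f a w v h h0.
  by have [/= Uy _] := rP _ (inr' s t sh th); split; [exact: df|exact: dDf].
have hn0 : h != 0 by rewrite gt_eqF.
have [_ [_ /= D1]] := rP _ (inr _ _ ch dh).
have [_ [/= D2 _]] := rP _ (inr' _ _ ch' dh').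
move: D1 D2 E1 E2; rewrite [a + h *: w + h *: v]addrAC.
set s := 'D_w ('D_v f) (a + c *: v + d *: w).
set t := 'D_v ('D_w f) (a + c' *: w + d' *: v) => D1 D2 E1 E2.
(* Both are the same second difference divided by h^2, so one common value lies within e / 2 of each
   mixed derivative at [a]. *)
clearbody s t; have st : s = t.
  apply: (mulfI hn0); apply: (mulfI hn0); rewrite -E1 -E2.
  move: (f _) (f _) (f _) (f _) => b1 b2 b3 b4; ring.
rewrite -st in D2; move: ('D_v _ a) ('D_w _ a) D1 D2 => b1 b2 D1 D2.
rewrite (splitr e) -(subrKA s); apply: le_trans (ler_normD _ _) _.
by rewrite [X in _ + X]distrC; apply: lerD; exact: ltW.
Qed.

End Schwarz.

(** * Smooth functions and vector fields in charts *)

Section Charts.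
Variables (R : realType) (m : nat) (M : manifold R m).
Implicit Types (i j k : idx M) (p q : M) (U V : set M).

Lemma chart_point i x : (coord i @` dom i) x ->
  dom i (param i x) /\ coord i (param i x) = x.
Proof. by move=> [q dq <-]; rewrite coordK. Qed.

Lemma chart_image_point U i x : (coord i @` (U `&` dom i)) x ->
  [/\ U (param i x), dom i (param i x) & coord i (param i x) = x].
Proof. by move=> [q [Uq dq] <-]; rewrite coordK. Qed.

Lemma open_chart_image U i : open U -> open (coord i @` (U `&` dom i)).
Proof.
move=> oU; rewrite openE => _ [q [Uq dq] <-]; rewrite /interior.
have nU : \forall x \near coord i q, U (param i x).
  by apply: (@param_continuous _ _ M i q dq); rewrite coordK //; exact: open_nbhs_nbhs.
have nd : \forall x \near coord i q, (coord i @` dom i) x.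
  by apply: open_nbhs_nbhs; split; [exact: codom_open|exists q].
apply: filterS2 nU nd => x Ux /chart_point[dx xE].
by exists (param i x).
Qed.

Lemma near_chart U i q : open U -> U q -> dom i q ->
  \forall x \near coord i q,
    [/\ U (param i x), dom i (param i x) & coord i (param i x) = x].
Proof.
move=> oU Uq dq; apply: filterS (@chart_image_point U i) _.
by apply: open_nbhs_nbhs; split; [exact: open_chart_image|exists q].
Qed.

Lemma transition_differentiable i j q : dom i q -> dom j q ->
  differentiable (coord j \o param i) (coord i q).
Proof.
by move=> di dj; apply: Cinfty_differentiable (@transition_smooth _ _ M i j) _; exists q.
Qed.

(* The components in chart [j] of the tangent vector at [q] with components [v] in
   chart [i]. *)
Definition change i j q (v : 'rV[R]_m) : 'rV[R]_m :=
  'D_v (coord j \o param i) (coord i q).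

Lemma change_linear i j q : dom i q -> dom j q -> linear (change i j q).
Proof.
move=> di dj a v w; have dc := transition_differentiable di dj.
by rewrite /change !deriveE // linearP.
Qed.

Lemma changeK i q v : dom i q -> change i i q v = v.
Proof.
move=> di; rewrite /change (@near_eq_derive _ _ _ _ id) ?derive_id //.
by apply: filterS (near_chart openT Logic.I di) => x [].
Qed.

(** The cocycle rule for Jacobians is the chain rule, since the transition maps compose as expected
    near [coord i q]. *)
Lemma change_comp i j k q v : dom i q -> dom j q -> dom k q ->
  change j k q (change i j q v) = change i k q v.
Proof.
move=> di dj dk; have ci := transition_differentiable di dj.
have cj := transition_differentiable dj dk.
have E : (coord j \o param i) (coord i q) = coord j q by rewrite /= coordK.
have := @derive_comp _ _ _ _ (coord k \o param j) _ _ v ci.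
rewrite E /change => <- //; apply: near_eq_derive; have := near_chart (@dom_open _ _ M j) dj di.
by apply: filterS => x [dx _ _] /=; rewrite coordK.
Qed.

(** Frees [dfun] from the chart [chart_at q]: with [i] fixed, the right side can be studied as [q]
    moves. *)
Lemma dfun_chart f i q x : dom i q ->
  differentiable (f \o param i) (coord i q) ->
  dfun f q x = 'D_(change (chart_at q) i q x) (f \o param i) (coord i q).
Proof.
move=> di df; have dc := mem_chart_at q.
have ci := transition_differentiable dc di.
have E : (coord i \o param (chart_at q)) (coord (chart_at q) q) = coord i q.
  by rewrite /= coordK.
have := @derive_comp _ _ _ _ (f \o param i) _ _ x ci.
rewrite E /dfun /change => <- //; apply: near_eq_derive.
have := near_chart (@dom_open _ _ M i) di dc.
by apply: filterS => y [dy _ _] /=; rewrite coordK.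
Qed.

Lemma smooth_near_differentiable f i p : smooth_near p f -> dom i p ->
  differentiable (f \o param i) (coord i p).
Proof.
by move=> [U [oU Up fU]] di; apply: Cinfty_differentiable (fU i) _; exists p.
Qed.

Lemma vsmooth_near_open (X : vfield M) p : vsmooth_near p X ->
  exists U : set M, [/\ open U, U p & forall q, U q -> vsmooth_near q X].
Proof. by move=> [U [oU Up XU]]; exists U; split=> // q Uq; exists U. Qed.

Lemma smooth_on_subset U V f : V `<=` U -> smooth_on U f -> smooth_on V f.
Proof.
move=> VU fU i k; apply: Ck_subset (fU i k).
by apply: image_subset => q [/VU]; split.
Qed.

Lemma vsmooth_on_subset U V (X : vfield M) : V `<=` U -> vsmooth_on U X -> vsmooth_on V X.
Proof.
move=> VU fU i k; apply: Ck_subset (fU i k).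
by apply: image_subset => q [/VU]; split.
Qed.

Lemma smooth_near_eq U f g p : open U -> U p -> (forall q, U q -> f q = g q) ->
  smooth_near p f -> smooth_near p g.
Proof.
move=> oU Up fg [V [oV Vp fV]]; exists (U `&` V); split=> //; first exact: openI.
move=> i k; have oI := open_chart_image (i := i) (openI oU oV).
apply: (Ck_eq oI) (smooth_on_subset (@subIsetr _ U V) fV i k) => x.
by move=> /chart_image_point[[Ux _] _ _] /=; exact: fg.
Qed.

Lemma vsmooth_near_eq U (X Y : vfield M) p : open U -> U p ->
  (forall q, U q -> X q = Y q) -> vsmooth_near p X -> vsmooth_near p Y.
Proof.
move=> oU Up fg [V [oV Vp fV]]; exists (U `&` V); split=> //; first exact: openI.
move=> i k; have oI := open_chart_image (i := i) (openI oU oV).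
apply: (Ck_eq oI) (vsmooth_on_subset (@subIsetr _ U V) fV i k) => x.
by move=> /chart_image_point[[Ux _] _ _] /=; rewrite /vcomp fg.
Qed.

Lemma smooth_near_cst p (c : R) : smooth_near (M := M) p (fun=> c).
Proof. by exists setT; split=> //; [exact: openT|move=> i k; exact: Ck_cst]. Qed.

Lemma smooth_near_op2 (op : R -> R -> R) f g p :
  (forall (U : set 'rV[R]_m) (a b : 'rV[R]_m -> R), open U ->
     Cinfty U a -> Cinfty U b -> Cinfty U (fun x => op (a x) (b x))) ->
  smooth_near p f -> smooth_near p g -> smooth_near p (fun q => op (f q) (g q)).
Proof.
move=> opC [U [oU Up fU]] [V [oV Vp gV]].
exists (U `&` V); split=> //; first exact: openI.
move=> i; apply: (opC _ (f \o param i) (g \o param i)).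
- exact: open_chart_image (openI oU oV).
- exact: smooth_on_subset (@subIsetl _ U V) fU i.
- exact: smooth_on_subset (@subIsetr _ U V) gV i.
Qed.

Lemma smooth_near_add f g p : smooth_near p f -> smooth_near p g ->
  smooth_near p (fun q => f q + g q).
Proof. by apply: smooth_near_op2 => U a b; exact: Cinfty_add. Qed.

Lemma smooth_near_mul f g p : smooth_near p f -> smooth_near p g ->
  smooth_near p (fun q => f q * g q).
Proof. by apply: smooth_near_op2 => U a b; exact: Cinfty_mul. Qed.

Lemma smooth_near_sum (I : Type) (r : seq I) (P : pred I) (f : I -> M -> R) p :
  (forall l, P l -> smooth_near p (f l)) ->
  smooth_near p (fun q => \sum_(l <- r | P l) f l q).
Proof.
move=> fs; suff -> : (fun q => \sum_(l <- r | P l) f l q) = \sum_(l <- r | P l) f l.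
  by elim/big_rec: _ => [|l g Pl gs]; [exact: smooth_near_cst|exact: smooth_near_add (fs l Pl) gs].
by apply/funext => q; rewrite fct_sumE.
Qed.

Lemma smooth_near_prod (I : Type) (r : seq I) (P : pred I) (f : I -> M -> R) p :
  (forall l, P l -> smooth_near p (f l)) ->
  smooth_near p (fun q => \prod_(l <- r | P l) f l q).
Proof.
move=> fs; elim: r => [|l r IH].
  rewrite (_ : (fun q => _) = (fun=> 1)); first exact: smooth_near_cst.
  by apply/funext => q; rewrite big_nil.
have [Pl|Pl] := boolP (P l); last first.
  by rewrite (_ : (fun q => _) = (fun q => \prod_(l <- r | P l) f l q)) //;
    apply/funext => q; rewrite big_cons (negbTE Pl).
rewrite (_ : (fun q => _) = (fun q => f l q * \prod_(l <- r | P l) f l q)).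
  exact: smooth_near_mul (fs l Pl) IH.
by apply/funext => q; rewrite big_cons Pl.
Qed.

Lemma smooth_near_inv U f p : open U -> U p -> (forall q, U q -> f q != 0) ->
  smooth_near p f -> smooth_near p (fun q => (f q)^-1).
Proof.
move=> oU Up f0 [V [oV Vp fV]]; exists (U `&` V); split=> //; first exact: openI.
move=> i k; apply: Ck_inv (open_chart_image (i := i) (openI oU oV)) _ _.
  by move=> x /chart_image_point[[Ux _] _ _]; exact: f0.
exact: (smooth_on_subset (@subIsetr _ U V) fV).
Qed.

Lemma vcomp_linear i (X Y : vfield M) a q : dom i q ->
  vcomp i (fun q => a q *: X q + Y q) q = a q *: vcomp i X q + vcomp i Y q.
Proof. by move=> di; have := change_linear (mem_chart_at q) di (a q) (X q) (Y q). Qed.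

Lemma vsmooth_near_lin f (X Y : vfield M) p :
  smooth_near p f -> vsmooth_near p X -> vsmooth_near p Y ->
  vsmooth_near p (fun q => f q *: X q + Y q).
Proof.
move=> [U [oU Up fU]] [V [oV Vp XV]] [W [oW Wp YW]].
exists (U `&` (V `&` W)); split=> //; first by do 2!apply: openI => //.
move=> i; have oI := open_chart_image (i := i) (openI oU (openI oV oW)).
apply: (Ck_row oI) => j k.
have fC : Ck k (coord i @` (U `&` (V `&` W) `&` dom i)) (f \o param i).
  by apply: (smooth_on_subset _ fU) => q [].
have XC : Ck k (coord i @` (U `&` (V `&` W) `&` dom i)) (vcomp i X \o param i).
  by apply: (vsmooth_on_subset _ XV) => q [_ []].
have YC : Ck k (coord i @` (U `&` (V `&` W) `&` dom i)) (vcomp i Y \o param i).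
  by apply: (vsmooth_on_subset _ YW) => q [_ []].
have S := Ck_add oI (Ck_mul oI fC (Ck_coord j oI XC)) (Ck_coord j oI YC).
apply: (Ck_eq oI _ S) => x /chart_image_point[_ dx _] /=.
by rewrite vcomp_linear // !mxE.
Qed.

Lemma vsmooth_near_0 p : vsmooth_near (M := M) p (fun=> 0).
Proof.
exists setT; split=> //; first exact: openT.
move=> i k; have oI := open_chart_image (i := i) (@openT M).
apply: (Ck_eq oI _ (Ck_cst k _ (0 : 'rV[R]_m))) => x _ /=.
by rewrite /vcomp derive0.
Qed.

Lemma vsmooth_near_scale f (X : vfield M) p :
  smooth_near p f -> vsmooth_near p X -> vsmooth_near p (fun q => f q *: X q).
Proof.
move=> fs Xs; have := vsmooth_near_lin fs Xs (vsmooth_near_0 p).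
by congr vsmooth_near; apply/funext => q; rewrite addr0.
Qed.

Lemma vsmooth_near_add (X Y : vfield M) p :
  vsmooth_near p X -> vsmooth_near p Y -> vsmooth_near p (fun q => X q + Y q).
Proof.
move=> Xs Ys; have := vsmooth_near_lin (smooth_near_cst p 1) Xs Ys.
by congr vsmooth_near; apply/funext => q; rewrite scale1r.
Qed.

Lemma vsmooth_near_sum (I : Type) (r : seq I) (P : pred I) (X : I -> vfield M) p :
  (forall l, P l -> vsmooth_near p (X l)) ->
  vsmooth_near p (fun q => \sum_(l <- r | P l) X l q).
Proof.
move=> Xs; suff -> : (fun q => \sum_(l <- r | P l) X l q) = \sum_(l <- r | P l) (X l : M -> _).
  by elim/big_rec: _ => [|l Y Pl Ys]; [exact: vsmooth_near_0|exact: vsmooth_near_add (Xs l Pl) Ys].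
by apply/funext => q; rewrite fct_sumE.
Qed.

End Charts.

(** * Coordinate fields, frames and differentials of functions *)

Section FieldsAndFunctions.
Variables (R : realType) (m : nat) (M : manifold R m).
Implicit Types (p q : M) (U V : set M) (f g u : M -> R) (X Y Z : vfield M).

Lemma linear_row_sum (W : lmodType R) (f : 'rV[R]_m -> W) v : linear f ->
  f v = \sum_j v 0 j *: f (delta_mx 0 j).
Proof.
move=> f_lin; pose fM := GRing.isLinear.Build _ _ _ _ _ f_lin.
pose fL : {linear _ -> _} := HB.pack f fM.
rewrite {1}(row_sum_delta v) -[f]/(fL : _ -> _) linear_sum.
by apply: eq_bigr => j _; rewrite linearZ.
Qed.

(** The field with constant components [v] in chart [i]; its values outside [dom i] carry no
    meaning. *)
Definition coord_field (i : idx M) (v : 'rV[R]_m) : vfield M :=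
  fun q => change i (chart_at q) q v.

(** In a chart [j] the components are a directional derivative of the transition from [i] to [j],
    composed with the transition back from [j] to [i]. *)
Lemma coord_field_smooth i v : vsmooth_on (dom i) (coord_field i v).
Proof.
move=> j; set A := coord j @` _; have oA : open A by exact/open_chart_image/dom_open.
apply: (Ck_row oA) => l k.
pose B := coord i @` (dom i `&` dom j).
have oB : open B by rewrite /B setIC; exact/open_chart_image/dom_open.
have TC : Ck k B (fun x => 'D_v (coord j \o param i) x 0 l).
  by apply: (Ck_coord l oB); apply: Cinfty_derive; exact: transition_smooth.
have AB x : A x -> B ((coord i \o param j) x).
  by move=> /chart_image_point[di dj _]; exists (param j x).
have SC : Ck k A (coord i \o param j).
  by rewrite /A setIC; exact: transition_smooth.
apply: (Ck_eq oA _ (Ck_comp oA AB TC SC)) => x /chart_image_point[di dj _] /=.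
by rewrite -[LHS]/(change i j (param j x) v 0 l) -(change_comp v di (mem_chart_at _) dj).
Qed.

(** Allows identities stated for smooth fields to be tested on arbitrary tangent vectors. *)
Lemma exists_field p v : exists2 X, vsmooth_near p X & X p = v.
Proof.
exists (coord_field (chart_at p) v); last exact/changeK/mem_chart_at.
exists (dom (chart_at p)); split; [exact: dom_open|exact: mem_chart_at|].
exact: coord_field_smooth.
Qed.

Lemma coord_frame i q : dom i q ->
  local_frame q (fun l => coord_field i (delta_mx 0 l)).
Proof.
move=> di; split=> [l|].
  by exists (dom i); split=> //; [exact: dom_open|exact: coord_field_smooth].
have dc := mem_chart_at q; set A := \matrix_i _.
pose B := \matrix_l change (chart_at q) i q (delta_mx 0 l).
suff AB : A *m B = 1%:M by have [+ _] := mulmx1_unit AB.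
apply/row_matrixP => l; rewrite row_mul rowK row1 /coord_field.
rewrite mulmx_sum_row.
under eq_bigr do rewrite rowK.
rewrite -(linear_row_sum _ (change_linear dc di)).
by rewrite change_comp // changeK.
Qed.

Lemma dfun_near_eq U f g p x : open U -> U p -> (forall q, U q -> f q = g q) ->
  dfun f p x = dfun g p x.
Proof.
move=> oU Up fg; apply: near_eq_derive.
apply: filterS (near_chart oU Up (mem_chart_at p)) => y [Uy _ _] /=.
exact: fg.
Qed.

Lemma smooth_near_diff f p : smooth_near p f ->
  differentiable (f \o param (chart_at p)) (coord (chart_at p) p).
Proof. by move=> fs; apply: smooth_near_differentiable fs (mem_chart_at p). Qed.

Lemma dfun_linear f p : smooth_near p f -> linear (dfun f p : _ -> R).
Proof.
by move=> /smooth_near_diff df a v w; rewrite /dfun !deriveE // linearP.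
Qed.

Lemma dfun_cst (c : R) p x : dfun (M := M) (fun=> c) p x = 0.
Proof. by rewrite /dfun; exact: derive_cst. Qed.

Lemma dfun_add f g p x : smooth_near p f -> smooth_near p g ->
  dfun (fun q => f q + g q) p x = dfun f p x + dfun g p x.
Proof.
move=> /smooth_near_diff df /smooth_near_diff dg; rewrite /dfun.
by apply: deriveD; exact: diff_derivable.
Qed.

Lemma dfun_scale (c : R) f p x : smooth_near p f ->
  dfun (fun q => c * f q) p x = c * dfun f p x.
Proof.
by move=> /smooth_near_diff df; apply: deriveZ; exact: diff_derivable.
Qed.

Lemma dfun_exp_mul u f p x : smooth_near p u -> smooth_near p f ->
  dfun (fun q => expR (2 * u q) * f q) p x
  = expR (2 * u p) * (2 * dfun u p x * f p + dfun f p x).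
Proof.
move=> us fs; have du := smooth_near_diff us; have df := smooth_near_diff fs.
rewrite /dfun; set c := chart_at p; set a := coord c p.
have pa : param c a = p by rewrite /a coordK //; exact: mem_chart_at.
pose u2 := fun y => 2 * (u \o param c) y.
have du2 : differentiable u2 a by exact: differentiableZ.
have de : differentiable expR (u2 a) by apply/derivable1_diffP; exact: derivable_expR.
have -> : (fun q => expR (2 * u q) * f q) \o param c =
  (expR \o u2) * (f \o param c) by [].
rewrite deriveM; [|exact/diff_derivable/differentiable_comp|exact: diff_derivable].
rewrite derive_comp //.
have -> : 'D_('D_x u2 a) expR (u2 a) = 'D_x u2 a * expR (u2 a).
  rewrite deriveE // deriv1E; last exact: derivable_expR.
  by rewrite derive1E derive_val.
have -> : 'D_x u2 a = 2 * 'D_x (u \o param c) a.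
  by apply: deriveZ; exact: diff_derivable.
rewrite /= /u2 /= pa /GRing.scale /=; ring.
Qed.

Lemma dfun_smooth u Y p : smooth_near p u -> vsmooth_near p Y ->
  smooth_near p (fun q => dfun u q (Y q)).
Proof.
move=> [U [oU Up us]] [V [oV Vp Ys]].
exists (U `&` V); split=> //; first exact: openI.
move=> i k; have oI := open_chart_image (i := i) (openI oU oV).
have uC := smooth_on_subset (@subIsetl _ U V) us i.
have YC := vsmooth_on_subset (@subIsetr _ U V) Ys i.
pose h x := \sum_j vcomp i Y (param i x) 0 j * 'D_(delta_mx 0 j) (u \o param i) x.
have hC : Ck k (coord i @` (U `&` V `&` dom i)) h.
  apply: (Ck_sum _ oI) => j _; apply: (Ck_mul oI).
    by apply: (Ck_coord j oI); exact: YC.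
  exact: Cinfty_derive.
apply: (Ck_eq oI _ hC) => x Ux; have [[Uq Vq] dq xE] := chart_image_point Ux.
have du : differentiable (u \o param i) x by exact: Cinfty_differentiable uC Ux.
by rewrite /h -derive_row_sum //= (dfun_chart _ dq) xE.
Qed.

End FieldsAndFunctions.

(** * Closedness of the differential of a function *)

Lemma derive_mul (R : realType) (E : normedModType R) (f g : E -> R) x v :
  differentiable f x -> differentiable g x ->
  'D_v (fun y => f y * g y) x = f x * 'D_v g x + 'D_v f x * g x.
Proof.
move=> df dg; rewrite [LHS](@deriveM _ _ f g); [|exact: diff_derivable..].
by rewrite [X in _ + X]mulrC.
Qed.

Lemma derive_subl (R : realType) (E F : normedModType R) (f : E -> F) x v w :
  differentiable f x -> 'D_(v - w) f x = 'D_v f x - 'D_w f x.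
Proof. by move=> df; rewrite !deriveE // linearB. Qed.

Section ExactForms.
Variables (R : realType) (m : nat) (M : manifold R m).
Implicit Types (p q : M) (u : M -> R) (X Y : vfield M).

(** Separates a term that will match half of the bracket from a Hessian term of [u], symmetric in
    [X p] and [Y p]. *)
Lemma dfun_dfun u X Y p (c := chart_at p) (a := coord c p) :
  smooth_near p u -> vsmooth_near p Y ->
  dfun (fun q => dfun u q (Y q)) p (X p) =
    'D_('D_(X p) (vcomp c Y \o param c) a) (u \o param c) a
    + 'D_(Y p) ('D_(X p) (u \o param c)) a.
Proof.
move=> us Ys; have [U [oU Up uU]] := us; have [V [oV Vp YV]] := Ys.
have dc : dom c p by exact: mem_chart_at.
pose Yc := vcomp c Y \o param c; pose uc := u \o param c.
have Aa : (coord c @` (U `&` V `&` dom c)) a by exists p.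
have oA := open_chart_image (i := c) (openI oU oV).
have uC : Cinfty (coord c @` (U `&` V `&` dom c)) uc.
  exact: smooth_on_subset (@subIsetl _ U V) uU c.
have YC : Cinfty (coord c @` (U `&` V `&` dom c)) Yc.
  exact: vsmooth_on_subset (@subIsetr _ U V) YV c.
have Ya : Yc a = Y p by rewrite /Yc /= coordK // /vcomp; exact: changeK.
have duc x : (coord c @` (U `&` V `&` dom c)) x -> differentiable uc x.
  by move=> Ax; exact: Cinfty_differentiable uC Ax.
have dYc : differentiable Yc a by exact: Cinfty_differentiable YC Aa.
have dD v : differentiable ('D_v uc) a.
  by apply: Cinfty_differentiable (Cinfty_derive _ uC) Aa.
have dY j : differentiable (fun x => Yc x 0 j) a.
  by apply: Cinfty_differentiable Aa => k; apply: (Ck_coord j oA); exact: YC.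
rewrite {1}/dfun -/c -/a.
pose h j x := Yc x 0 j * 'D_(delta_mx 0 j) uc x.
have dh j : differentiable (h j) a by exact: differentiableM.
(* Near [a] the function is rewritten entirely in chart [c], as the components of [Y] times the
   partial derivatives of [u]. *)
rewrite (@near_eq_derive _ _ _ _ (\sum_j h j)); last first.
  apply: filterS (open_nbhs_nbhs (conj oA Aa)) => x Ax.
  have [_ dq xE] := chart_image_point Ax.
  rewrite fct_sumE /= (@dfun_chart _ _ _ _ c _ _ dq) xE; last exact: duc.
  by rewrite (derive_row_sum _ (duc x Ax)).
rewrite derive_sum => [|j]; last exact: diff_derivable.
rewrite (derive_row_sum _ (duc a Aa)) (derive_row_sum _ (dD (X p))) -big_split /=.
apply: eq_bigr => j _; rewrite /h (derive_mul _ (dY j) (dD _)) Ya addrC.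
rewrite (derive_schwarz _ _ oA Aa (uC 2%N)); congr (_ * _ + _).
by rewrite (derive_mx (@diff_derivable _ _ _ _ _ (X p) dYc)) mxE.
Qed.

Lemma dform_dfun u X Y p : smooth_near p u ->
  vsmooth_near p X -> vsmooth_near p Y -> dform (dfun u) p X Y = 0.
Proof.
move=> us Xs Ys; rewrite /dform !dfun_dfun //.
have [U [oU Up uU]] := us; set c := chart_at p.
have Aa : (coord c @` (U `&` dom c)) (coord c p).
  by exists p => //; split => //; exact: mem_chart_at.
rewrite (derive_schwarz (X p) (Y p) (open_chart_image oU) Aa (uU c 2%N)).
have duc := smooth_near_diff us.
have -> : dfun u p (bracket X Y p) =
    'D_('D_(X p) (vcomp c Y \o param c) (coord c p)) (u \o param c) (coord c p)
    - 'D_('D_(Y p) (vcomp c X \o param c) (coord c p)) (u \o param c) (coord c p).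
  exact: derive_subl.
have cancel (a b s : R) : a + s - (b + s) - (a - b) = 0 by ring.
exact: cancel.
Qed.

End ExactForms.

(** The indicator of [U] equals 1 near [p], hence is smooth there with zero differential, and
    multiplying by it makes the two fields equal everywhere. It plays the part of a bump
    function. *)
Lemma connection_local (R : realType) (m : nat) (M : manifold R m) (D : covder M)
    (U : set M) (Y Z : vfield M) p x :
  is_connection D -> open U -> U p -> (forall q, U q -> Y q = Z q) ->
  vsmooth_near p Y -> D p x Y = D p x Z.
Proof.
move=> Dc oU Up YZ Ys; have Zs := vsmooth_near_eq oU Up YZ Ys.
pose f q : R := (`[< U q >])%:R.
have f1 q : U q -> 1 = f q by move=> Uq; rewrite /f asboolT.
have fs : smooth_near p f := smooth_near_eq oU Up f1 (smooth_near_cst p 1).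
have fYZ : (fun q => f q *: Y q) = (fun q => f q *: Z q).
  apply/funext => q; rewrite /f; case: asboolP => [Uq|_]; first by rewrite YZ.
  by rewrite !scale0r.
have := conn_leibniz Dc x fs Ys; rewrite fYZ (conn_leibniz Dc x fs Zs).
by rewrite -(dfun_near_eq x oU Up f1) dfun_cst !scale0r !add0r -(f1 p Up) !scale1r.
Qed.

(** * Linear algebra of metrics and complex structures *)

Section ComplexStructureTrace.
Variable R : realFieldType.

Lemma irreducible_Xsqr_add1 : irreducible_poly ('X^2 + 1 : {poly R}).
Proof.
apply: cubic_irreducible => [|x]; first by rewrite size_XnaddC.
by rewrite rootE !hornerE gt_eqF // ltr_wpDl // sqr_ge0.
Qed.

(** Either [p] is coprime to [q], hence to [q ^+ N] and to its own multiple, which forces [p = 1];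
    or one factor [q] splits off and the exponent drops. *)
Lemma monic_dvdp_irreducible_exp (q p : {poly R}) N :
  irreducible_poly q -> q \is monic -> p \is monic -> p %| q ^+ N ->
  exists k, p = q ^+ k.
Proof.
move=> q_irr q_mon; elim: N p => [|N IH] p p_mon.
  rewrite expr0 dvdp1 => sp; exists 0%N; rewrite expr0.
  by apply/eqP; rewrite -eqp_monic ?monic1 // -size_poly_eq1.
move=> pq; have [cop|/(eqp_dvdl p)] := irredp_XsubCP q_irr (dvdp_gcdl q p).
  have : coprimep p p.
    by apply: coprimep_dvdl pq _; apply: coprimep_expr; rewrite coprimep_sym -gcdp_eqp1.
  rewrite coprimepp => sp; exists 0%N; rewrite expr0.
  by apply/eqP; rewrite -eqp_monic ?monic1 // -size_poly_eq1.
rewrite dvdp_gcdr => /esym /dvdpP[r rE].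
have r_mon : r \is monic by move: p_mon; rewrite rE monicMr.
have [|k rk] := IH r r_mon.
  by move: pq; rewrite rE exprSr dvdp_mul2r // irredp_neq0.
by exists k.+1; rewrite exprSr -rk.
Qed.
(* The characteristic polynomial divides a power of the irreducible X^2 + 1, so it is a
   polynomial in X^2. *)
Lemma trace_complex_structure n (J : 'M[R]_n.*2) : J *m J = - 1%:M -> \tr J = 0.
Proof.
case: n J => [|n] J JJ; first by rewrite /mxtrace big_ord0.
pose q : {poly R} := 'X^2 + 1.
have q_mon : q \is monic by rewrite /q monicXnaddC.
(* (X - J)(X + J) = X^2 - J^2 = X^2 + 1; determinants then exhibit the characteristic polynomial as
   a divisor of a power of [q]. *)
have cJ : char_poly_mx J *m ('X%:M + map_mx polyC J) = q%:M.
  rewrite /char_poly_mx mulmxDl !mulmxDr !mulNmx -map_mxM JJ.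
  rewrite (scalar_mxC 'X (map_mx polyC J)) -scalar_mxM addrA addrK.
  by rewrite map_mxN map_mx1 opprK /q [in RHS]raddfD /= expr2.
have dvd : char_poly J %| q ^+ n.+1.*2.
  apply/dvdpP; exists (\det ('X%:M + map_mx polyC J)).
  by rewrite mulrC -det_mulmx cJ det_scalar.
have [k cE] := monic_dvdp_irreducible_exp irreducible_Xsqr_add1 q_mon (char_poly_monic J) dvd.
apply: oppr_inj; rewrite -char_poly_trace // cE oppr0.
have -> : q ^+ k = (('X + 1) ^+ k) \Po 'X^2.
  by rewrite rmorphXn /= rmorphD /= comp_polyX rmorph1.
by rewrite coef_comp_poly_Xn // dvdn2 /= odd_double.
Qed.

End ComplexStructureTrace.

(** * Bilinear forms, index raising and metric contractions *)

Section BilinearForms.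
Variables (R : realType) (m : nat).
Implicit Types (A : 'M[R]_m) (x y z : 'rV[R]_m).

Lemma bilDl A x y z : bil A (x + y) z = bil A x z + bil A y z.
Proof. by rewrite /bil !mulmxDl mxE. Qed.

Lemma bilDr A x y z : bil A x (y + z) = bil A x y + bil A x z.
Proof. by rewrite /bil linearD /= mulmxDr mxE. Qed.

Lemma bilZl A a x y : bil A (a *: x) y = a * bil A x y.
Proof. by rewrite /bil -!scalemxAl mxE. Qed.

Lemma bilZr A a x y : bil A x (a *: y) = a * bil A x y.
Proof. by rewrite /bil linearZ /= -scalemxAr mxE. Qed.

Lemma bilNl A x y : bil A (- x) y = - bil A x y.
Proof. by rewrite -scaleN1r bilZl mulN1r. Qed.

Lemma bilNr A x y : bil A x (- y) = - bil A x y.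
Proof. by rewrite -scaleN1r bilZr mulN1r. Qed.

Lemma bil_scale A a x y : bil (a *: A) x y = a * bil A x y.
Proof. by rewrite /bil -scalemxAr -scalemxAl mxE. Qed.

Lemma bil_delta A x l : bil A x (delta_mx 0 l) = (x *m A) 0 l.
Proof.
rewrite /bil trmx_delta mxE (bigD1 l) //= big1 => [|j jl].
  by rewrite !mxE !eqxx mulr1 addr0.
by rewrite !mxE (negbTE jl) mulr0.
Qed.

Lemma bil_nondegenerate A x y : A \in unitmx ->
  (forall z, bil A x z = bil A y z) -> x = y.
Proof.
move=> Au xy; rewrite -[x](mulmxK Au) -[y](mulmxK Au); congr (_ *m _).
by apply/rowP => l; rewrite -!bil_delta.
Qed.

(** The musical isomorphism from forms to vectors; applied to [dfun u p] it gives the gradient of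
    [u]. *)
Definition raise A (f : 'rV[R]_m -> R) : 'rV[R]_m :=
  (\row_l f (delta_mx 0 l)) *m invmx A.

Lemma bil_raise A (f : 'rV[R]_m -> R) x : A \in unitmx -> linear (f : _ -> R) ->
  bil A (raise A f) x = f x.
Proof.
move=> Au f_lin; rewrite /bil /raise mulmxKV // (linear_row_sum _ f_lin).
by rewrite mxE; apply: eq_bigr => l _; rewrite !mxE mulrC.
Qed.

(** Together with [contract_comp], this evaluates every trace that arises when the conformal change
    of F is contracted to the Lie form. *)
Lemma contract_linear A (f : 'rV[R]_m -> R) z : A \in unitmx ->
  (forall x y, bil A x y = bil A y x) -> linear (f : _ -> R) ->
  \sum_i \sum_j invmx A i j * (f (delta_mx 0 j) * bil A (delta_mx 0 i) z) = f z.
Proof.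
move=> Au A_sym f_lin; rewrite exchange_big /= (linear_row_sum z f_lin).
apply: eq_bigr => j _; rewrite -[in RHS](mulmxK Au z) mxE /GRing.scale /= mulr_suml.
by apply: eq_bigr => i _; rewrite A_sym bil_delta; ring.
Qed.

Lemma contract_comp A (B : 'M[R]_m) : A \in unitmx ->
  (forall x y, bil A x y = bil A y x) ->
  \sum_i \sum_j invmx A i j * bil A (delta_mx 0 i) (delta_mx 0 j *m B) = \tr B.
Proof.
move=> Au A_sym; rewrite -[in RHS](mulmxK Au B) mxtrace_mulC /mxtrace.
apply: eq_bigr => i _; rewrite mxE; apply: eq_bigr => j _.
by rewrite A_sym bil_delta -rowE -row_mul mxE.
Qed.

End BilinearForms.

(** * Adding closed multiples of the identity and of J to a complex connection *)

Section GaugeChange.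
Variables (R : realType) (m : nat) (M : manifold R m).
Variables (J : tensor2 M) (D1 D2 : covder M) (a b : form1 M).
Hypothesis J_acs : almost_complex J.
Hypothesis D1_conn : is_connection D1.
Hypothesis D1_complex : forall p x Y, vsmooth_near p Y ->
  D1 p x (applyf J Y) = D1 p x Y *m J p.
Hypothesis D2E : forall p x Y, vsmooth_near p Y ->
  D2 p x Y = D1 p x Y + (a p x *: Y p + b p x *: (Y p *m J p)).
Hypothesis a_smooth : forall p X, vsmooth_near p X -> smooth_near p (fun q => a q (X q)).
Hypothesis b_smooth : forall p X, vsmooth_near p X -> smooth_near p (fun q => b q (X q)).

(** The Leibniz rule for [D1], with J moved outside by [D1_complex]; the minus sign in the last line
    is J^2 = -1. *)
Lemma gauge_second_derivative p x (Y Z : vfield M) :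
  vsmooth_near p Y -> vsmooth_near p Z ->
  let DZ := D1 p (Y p) Z in let z := Z p in
  D2 p x (fun q => D2 q (Y q) Z) =
    D1 p x (fun q => D1 q (Y q) Z)
    + (dfun (fun q => a q (Y q)) p x *: z + a p (Y p) *: D1 p x Z)
    + (dfun (fun q => b q (Y q)) p x *: (z *m J p) + b p (Y p) *: (D1 p x Z *m J p))
    + (a p x *: (DZ + a p (Y p) *: z + b p (Y p) *: (z *m J p))
      + b p x *: (DZ *m J p + a p (Y p) *: (z *m J p) - b p (Y p) *: z)).
Proof.
move=> Ys Zs DZ z; have [U [oU Up ZU]] := vsmooth_near_open Zs.
pose A q := D1 q (Y q) Z.
pose B q := a q (Y q) *: Z q; pose C q := b q (Y q) *: applyf J Z q.
pose V q := (A q + B q) + C q.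
(* [D2E] speaks only of points near which [Z] is smooth, so the inner field is known on [U] alone
   and locality of [D1] has to bridge the gap. *)
have VE q : U q -> V q = D2 q (Y q) Z.
  by move=> Uq; rewrite D2E ?addrA //; exact: ZU.
have JZs := acs_smooth J_acs Zs.
have As : vsmooth_near p A by exact: conn_smooth.
have Bs : vsmooth_near p B by apply: vsmooth_near_scale => //; exact: a_smooth.
have Cs : vsmooth_near p C by apply: vsmooth_near_scale => //; exact: b_smooth.
have ABs : vsmooth_near p (fun q => A q + B q) by exact: vsmooth_near_add.
have Vs : vsmooth_near p V by exact: vsmooth_near_add.
have Vs' := vsmooth_near_eq oU Up VE Vs.
rewrite D2E // -(connection_local x D1_conn oU Up VE Vs) -(VE p Up).
rewrite (conn_add D1_conn x ABs Cs) (conn_add D1_conn x As Bs).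
rewrite (conn_leibniz D1_conn x (a_smooth Ys) Zs).
rewrite (conn_leibniz D1_conn x (b_smooth Ys) JZs) D1_complex //.
congr (_ + (_ + _)); rewrite /V /A /B /C /applyf !mulmxDl -!scalemxAl.
by rewrite (acs_sqr J_acs) scalerN.
Qed.

(** Beyond the derivatives of [a] and [b], the new terms in the second derivative are symmetric in
    [X] and [Y]: sums like a(X) D_Y Z + a(Y) D_X Z, and products such as a(X) a(Y) - b(X) b(Y). They
    cancel on antisymmetrization. *)
Lemma gauge_curvature p (X Y Z : vfield M) :
  dform a p X Y = 0 -> dform b p X Y = 0 ->
  vsmooth_near p X -> vsmooth_near p Y -> vsmooth_near p Z ->
  curvature D2 p X Y Z = curvature D1 p X Y Z.
Proof.
rewrite /dform => da db Xs Ys Zs; rewrite /curvature !gauge_second_derivative //= D2E //.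
(* Closedness enters as a formula for the value on the bracket, which is what [D2] along the bracket
   contributes. *)
have {da} -> : a p (bracket X Y p) =
    dfun (fun q => a q (Y q)) p (X p) - dfun (fun q => a q (X q)) p (Y p).
  by apply/esym/subr0_eq.
have {db} -> : b p (bracket X Y p) =
    dfun (fun q => b q (Y q)) p (X p) - dfun (fun q => b q (X q)) p (Y p).
  by apply/esym/subr0_eq.
move: (D1 p (X p) _) (D1 p (Y p) (fun=> _)) (D1 p (bracket X Y p) Z) => dXY dYX dB.
move: (D1 p (X p) Z) (D1 p (Y p) Z) => dX dY.
move: (dX *m J p) (dY *m J p) (Z p *m J p) (Z p) => JdX JdY Jz z.
by apply/rowP => l; rewrite !mxE; ring.
Qed.

End GaugeChange.

(** * Smoothness of the Lie form and of the connection nabla' *)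

Section LieForm.
Variables (R : realType) (m : nat) (M : manifold R m).
Implicit Types (p q : M) (J g : tensor2 M) (D : covder M) (X Y Z : vfield M).

Lemma smooth_near_det k (A : M -> 'M[R]_k) p :
  (forall i j, smooth_near p (fun q => A q i j)) ->
  smooth_near p (fun q => \det (A q)).
Proof.
move=> As; apply: smooth_near_sum => s _; apply: smooth_near_mul.
  exact: smooth_near_cst.
by apply: smooth_near_prod => i _; exact: As.
Qed.

Lemma smooth_near_invmx k (A : M -> 'M[R]_k) U p i j : open U -> U p ->
  (forall q, U q -> A q \in unitmx) ->
  (forall i j, smooth_near p (fun q => A q i j)) ->
  smooth_near p (fun q => invmx (A q) i j).
Proof.
move=> oU Up Au As.
have cofs : smooth_near p (fun q => (\det (A q))^-1 * cofactor (A q) j i).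
  apply: smooth_near_mul.
    apply: (smooth_near_inv oU Up) (smooth_near_det As) => q /Au.
    by rewrite unitmxE unitfE.
  apply: smooth_near_mul; first exact: smooth_near_cst.
  apply: smooth_near_det => k1 k2; have := As (lift j k1) (lift i k2).
  by congr smooth_near; apply/funext => q; rewrite !mxE.
apply: (smooth_near_eq oU Up) cofs => q Uq.
by rewrite /invmx Au // !mxE.
Qed.

Lemma gram_matrix (A : 'M[R]_m) (v : 'I_m -> 'rV[R]_m) :
  \matrix_(k, l) bil A (v k) (v l) =
    \matrix_k v k *m A *m (\matrix_k v k)^T.
Proof.
apply/matrixP => k l; rewrite mxE /bil !mxE.
apply: eq_bigr => j _; rewrite !mxE; congr (_ * _).
by apply: eq_bigr => h _; rewrite !mxE.
Qed.

Lemma gram_unit (A : 'M[R]_m) (v : 'I_m -> 'rV[R]_m) : A \in unitmx ->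
  \matrix_k v k \in unitmx -> \matrix_(k, l) bil A (v k) (v l) \in unitmx.
Proof. by move=> Au vu; rewrite gram_matrix !unitmx_mul unitmx_tr vu Au. Qed.

Lemma gram_inverse_smooth g (e : 'I_m -> vfield M) U p i j :
  pseudo_riemannian g -> open U -> U p -> (forall q, U q -> local_frame q e) ->
  smooth_near p (fun q => invmx (\matrix_(k, l) bil (g q) (e k q) (e l q)) i j).
Proof.
move=> gP oU Up eU; apply: (smooth_near_invmx _ _ oU Up).
  move=> q /eU[_ eu]; apply: gram_unit => //; exact: metric_nondegenerate.
move=> k l; have [es _] := eU p Up.
have := metric_smooth gP (es k) (es l).
by congr smooth_near; apply/funext => q; rewrite mxE.
Qed.

(** The defining contraction may be computed in any frame; the coordinate frame of a single chart
    serves on a whole neighbourhood and has smooth ingredients. *)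
Lemma lie_form_smooth J g D theta p Z :
  almost_complex J -> pseudo_riemannian g -> is_connection D ->
  lie_form J g D theta -> vsmooth_near p Z ->
  smooth_near p (fun q => theta q (Z q)).
Proof.
move=> JP gP DP thE Zs; pose i := chart_at p.
pose e l := coord_field i (delta_mx 0 l).
have oU : open (dom i) by exact: dom_open.
have Up : dom i p by exact: mem_chart_at.
have eU q : dom i q -> local_frame q e by exact: coord_frame.
have [es _] := eU p Up.
have E q : dom i q ->
    \sum_k \sum_l invmx (\matrix_(k, l) bil (g q) (e k q) (e l q)) k l
      * Ftensor J g D q (e k q) (e l) (Z q) = theta q (Z q).
  by move=> /eU /thE ->.
apply: (smooth_near_eq oU Up E); apply: smooth_near_sum => k _.
apply: smooth_near_sum => l _; apply: smooth_near_mul.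
  exact: gram_inverse_smooth oU Up eU.
apply: (metric_smooth gP _ Zs).
have s1 := conn_smooth DP (es k) (acs_smooth JP (es l)).
have s2 := acs_smooth JP (conn_smooth DP (es k) (es l)).
have := vsmooth_near_lin (smooth_near_cst p (-1)) s2 s1.
by congr vsmooth_near; apply/funext => q; rewrite scaleN1r addrC.
Qed.

Lemma raise_frame (A : 'M[R]_m) (w : 'rV[R]_m) (v : 'I_m -> 'rV[R]_m) :
  A \in unitmx -> (forall x y, bil A x y = bil A y x) ->
  \matrix_k v k \in unitmx ->
  \sum_i \sum_j (invmx (\matrix_(k, l) bil A (v k) (v l)) i j * bil A (v i) w) *: v j = w.
Proof.
move=> Au A_sym vu; have := gram_unit Au vu; have := gram_matrix A v.
set G := \matrix_(k, l) _; set E := \matrix_k v k => GE Gu.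
have wE : w *m (A *m E^T) = \row_i bil A (v i) w.
  apply/rowP => i; rewrite [RHS]mxE A_sym /bil mulmxA mxE [RHS]mxE.
  by apply: eq_bigr => h _; rewrite !mxE.
(* Since G = E A E^T, the product in the order E (A E^T G^-1) is the identity, and a one-sided
   inverse of a square matrix is two-sided. *)
have inv : A *m E^T *m invmx G *m E = 1%:M.
  by apply: mulmx1C; rewrite !mulmxA -GE mulmxV.
rewrite -[RHS]mulmx1 -inv !mulmxA -[w *m A *m E^T]mulmxA wE.
rewrite exchange_big [RHS]mulmx_sum_row; apply: eq_bigr => j _.
rewrite -scaler_suml rowK; congr (_ *: _); rewrite mxE.
by apply: eq_bigr => i _; rewrite [in RHS]mxE mulrC.
Qed.

(** By [raise_frame], the components of [Omega] in a coordinate frame are inverse Gram entries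
    contracted with the smooth functions [theta q (e k q)]. *)
Lemma lie_vector_smooth g theta Omega p :
  pseudo_riemannian g -> lie_vector g theta Omega ->
  (forall Z, vsmooth_near p Z -> smooth_near p (fun q => theta q (Z q))) ->
  vsmooth_near p Omega.
Proof.
move=> gP OmE ths; pose i := chart_at p.
pose e l := coord_field i (delta_mx 0 l).
have oU : open (dom i) by exact: dom_open.
have Up : dom i p by exact: mem_chart_at.
have eU q : dom i q -> local_frame q e by exact: coord_frame.
have [es _] := eU p Up.
have E q : dom i q -> \sum_k \sum_l
    (invmx (\matrix_(k, l) bil (g q) (e k q) (e l q)) k l * theta q (e k q)) *: e l q
    = Omega q.
  move=> /eU[_ eu]; rewrite -[RHS](@raise_frame (g q) _ (fun l => e l q)) //.
  - by apply: eq_bigr => k _; apply: eq_bigr => l _; rewrite OmE.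
  - exact: metric_nondegenerate.
  - by move=> x y; exact: Defs.metric_sym.
apply: (vsmooth_near_eq oU Up E); apply: vsmooth_near_sum => k _.
apply: vsmooth_near_sum => l _; apply: vsmooth_near_scale => //.
apply: smooth_near_mul; last exact: ths.
exact: gram_inverse_smooth oU Up eU.
Qed.

Lemma dform_combination (w1 w2 : form1 M) (c1 c2 : R) p X Y :
  vsmooth_near p X -> vsmooth_near p Y ->
  (forall Z, vsmooth_near p Z -> smooth_near p (fun q => w1 q (Z q))) ->
  (forall Z, vsmooth_near p Z -> smooth_near p (fun q => w2 q (Z q))) ->
  dform (fun q x => c1 * w1 q x + c2 * w2 q x) p X Y
  = c1 * dform w1 p X Y + c2 * dform w2 p X Y.
Proof.
move=> Xs Ys s1 s2; have cs c w Z : smooth_near p (fun q => w q (Z q)) ->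
    smooth_near p (fun q => c * w q (Z q)).
  by move=> ws; apply: smooth_near_mul ws; exact: smooth_near_cst.
have dE Z x : vsmooth_near p Z ->
    dfun (fun q => c1 * w1 q (Z q) + c2 * w2 q (Z q)) p x
    = c1 * dfun (fun q => w1 q (Z q)) p x + c2 * dfun (fun q => w2 q (Z q)) p x.
  move=> Zs; rewrite dfun_add; [|exact/cs/s1|exact/cs/s2].
  by rewrite !dfun_scale; [|exact: s2|exact: s1].
by rewrite /dform !dE //; ring.
Qed.

End LieForm.

(** * The connection [nabla'] of a Norden manifold *)

Section ComplexConnection.
Variables (R : realType) (n : nat) (M : manifold R n.*2).
Variables (J g : tensor2 M) (D : covder M) (theta : form1 M) (Omega : vfield M).
Variables (l1 l2 l3 l4 : R).
Hypothesis nJg : norden J g.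
Hypothesis D_conn : is_connection D.
Hypothesis theta_Omega : lie_vector g theta Omega.
Let D' := nabla' J g D theta Omega l1 l2 l3 l4.
Let JJ : almost_complex J := norden_acs nJg.
Let gP : pseudo_riemannian g := norden_metric nJg.

Lemma norden_adjoint p x y : bil (g p) (x *m J p) y = bil (g p) x (y *m J p).
Proof.
have /= := norden_anti nJg p x (y *m J p).
by rewrite (acs_sqr JJ) bilNr => /oppr_inj.
Qed.

Lemma lie_form_linear p : linear (theta p : _ -> R).
Proof. by move=> k x y; rewrite !theta_Omega bilDl bilZl. Qed.

(** For S(x,y) = theta(Jy) x - g(x,y) J Omega one computes S(x,Jy) - J S(x,y) = -[g(x,y) Omega +
    g(x,Jy) J Omega + theta(y) x + theta(Jy) Jx], the negative of the bracket that W1 prescribes for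
    (D_x J) y. The terms with [l1] to [l4] commute with J. *)
Lemma nabla'_complex p x Y : W1 J g D theta -> vsmooth_near p Y ->
  D' p x (applyf J Y) = D' p x Y *m J p.
Proof.
move=> w1 Ys; pose c : R := (2 * n%:R)^-1.
have gu := metric_nondegenerate gP p.
have g_sym := Defs.metric_sym gP p.
(* W1 with its last index raised; self-adjointness of J carries [z *m J p] over to J Omega and
   Jx. *)
have DJ : D p x (applyf J Y) - D p x Y *m J p =
    c *: (bil (g p) x (Y p) *: Omega p
      + bil (g p) x (Y p *m J p) *: (Omega p *m J p)
      + theta p (Y p) *: x + theta p (Y p *m J p) *: (x *m J p)).
  apply: (bil_nondegenerate gu) => z.
  rewrite -[LHS]/(Ftensor J g D p x Y z) (w1 p x Y z Ys) /= -/c.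
  rewrite bilZl !bilDl !bilZl !norden_adjoint [bil _ (Omega p) z]g_sym.
  by rewrite [bil _ (Omega p) (z *m _)]g_sym -!theta_Omega; ring.
have JK (v : 'rV[R]_n.*2) : v *m J p *m J p = - v by exact: (acs_sqr JJ p v).
rewrite /D' /nabla' -/c -[D p x (applyf J Y)](subrK (D p x Y *m J p)) DJ /applyf.
have -> : theta p (Y p *m J p *m J p) = - theta p (Y p).
  by rewrite JK !theta_Omega bilNl.
rewrite !(mulmxDl, mulNmx) -!scalemxAl !(mulmxDl, mulNmx) -!scalemxAl !JK.
move: (theta p _) (theta p _) (theta p _) (theta p _) => t1 t2 t3 t4.
move: (bil _ _ _) (bil _ _ _) => b1 b2; clearbody c; clear.
move: (Omega p *m J p) (Omega p) (D p x Y *m J p) => OJ O DJ.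
move: (Y p *m J p) (Y p) (x *m J p) => yJ y xJ.
by apply/rowP => l; rewrite !mxE; ring.
Qed.

Hypothesis theta_smooth : forall p Z, vsmooth_near p Z ->
  smooth_near p (fun q => theta q (Z q)).

Lemma nabla'_connection : is_connection D'.
Proof.
have Omega_smooth p : vsmooth_near p Omega.
  by apply: (lie_vector_smooth gP theta_Omega) => Z; exact: theta_smooth.
split.
- move=> p Y Ys k x x'; rewrite /D' /nabla' (conn_linear D_conn Ys).
  rewrite mulmxDl -scalemxAl !lie_form_linear bilDl bilZl /GRing.scale /=.
  move: (D p x Y) (D p x' Y) => d1 d2.
  move: (theta p _) (theta p _) (theta p _) (theta p _) (theta p _) => t1 t2 t3 t4 t5.
  by apply/rowP => l; rewrite !mxE /=; ring.
- move=> p x Y Z Ys Zs; rewrite /D' /nabla' (conn_add D_conn x Ys Zs).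
  rewrite mulmxDl bilDr; have := lie_form_linear p 1 (Y p *m J p) (Z p *m J p).
  rewrite !scale1r => ->; move: (D p x Y) (D p x Z) => d1 d2.
  move: (Y p *m J p) (Z p *m J p) => yJ zJ.
  by apply/rowP => l; rewrite !mxE /=; ring.
- move=> p x f Y fs Ys; rewrite /D' /nabla' (conn_leibniz D_conn x fs Ys).
  rewrite -scalemxAl bilZr; have := lie_form_linear p (f p) (Y p *m J p) 0.
  rewrite addr0 => ->; have -> : theta p 0 = 0.
    by rewrite theta_Omega -(scale0r 0) bilZl mul0r.
  rewrite addr0 [f p *: theta _ _]/GRing.scale /=; move: (D p x Y) (Y p *m J p) => d yJ.
  by apply/rowP => l; rewrite !mxE /=; ring.
move=> p X Y Xs Ys.
have JX := acs_smooth JJ Xs; have JY := acs_smooth JJ Ys; have JO := acs_smooth JJ (Omega_smooth p).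
have tJX := theta_smooth JX; have tX := theta_smooth Xs; have tJY := theta_smooth JY.
have cs c (f : M -> R) : smooth_near p f -> smooth_near p (fun q => c * f q).
  by move=> fs; apply: smooth_near_mul fs; exact: smooth_near_cst.
have vs c (V : vfield M) : vsmooth_near p V -> vsmooth_near p (fun q => c *: V q).
  by move=> Vs; apply: vsmooth_near_scale Vs; exact: smooth_near_cst.
have vN (V : vfield M) : vsmooth_near p V -> vsmooth_near p (fun q => - V q).
  by move=> /(vs (-1)); congr vsmooth_near; apply/funext => q; rewrite scaleN1r.
have s0 := conn_smooth D_conn Xs Ys.
have sg := vN _ (vsmooth_near_scale (metric_smooth gP Xs Ys) JO).
have s1 := vs (2 * n%:R)^-1 _ (vsmooth_near_add (vsmooth_near_scale tJY Xs) sg).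
have y1 := vsmooth_near_scale (cs l1 _ tX) Ys.
have y2 := vsmooth_near_scale (cs l2 _ tX) JY.
have y3 := vsmooth_near_scale (cs l3 _ tJX) Ys.
have y4 := vsmooth_near_scale (cs l4 _ tJX) JY.
have s2 := vs n%:R^-1 _ (vsmooth_near_add (vsmooth_near_add (vsmooth_near_add y1 y2) y3) y4).
exact: vsmooth_near_add (vsmooth_near_add s0 s1) s2.
Qed.

End ComplexConnection.

(** * Conformal change *)

Section ConformalLeviCivita.
Variables (R : realType) (m : nat) (M : manifold R m).
Variables (g : tensor2 M) (u : M -> R) (D Dbar : covder M).
Hypothesis gP : pseudo_riemannian g.
Hypothesis u_smooth : forall p, smooth_near p u.
Hypothesis D_lc : levi_civita g D.
Hypothesis Dbar_lc : levi_civita (conformal u g) Dbar.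

Let grad p := raise (g p) (dfun u p).

Lemma bil_grad p x : bil (g p) (grad p) x = dfun u p x.
Proof.
apply: bil_raise; first exact: metric_nondegenerate.
exact: dfun_linear.
Qed.

Lemma conformal_levi_civita p x Y : vsmooth_near p Y ->
  Dbar p x Y = D p x Y + dfun u p x *: Y p + dfun u p (Y p) *: x
               - bil (g p) x (Y p) *: grad p.
Proof.
move=> Ys; have [X Xs <-] := exists_field p x.
have gu := metric_nondegenerate gP p; have g_sym := Defs.metric_sym gP p.
apply: (bil_nondegenerate gu) => z; have [Z Zs <-] := exists_field p z => {x z}.
(* The defect [t] of the identity is symmetric in its first two arguments because both
   connections are torsion-free, and skew in the last two because both are metric. *)
pose t X Y Z := bil (g p) (Dbar p (X p) Y) (Z p) - bil (g p) (D p (X p) Y) (Z p)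
  - dfun u p (X p) * bil (g p) (Y p) (Z p) - dfun u p (Y p) * bil (g p) (X p) (Z p)
  + bil (g p) (X p) (Y p) * dfun u p (Z p).
have t_sym X1 Y1 Z1 : vsmooth_near p X1 -> vsmooth_near p Y1 -> t X1 Y1 Z1 = t Y1 X1 Z1.
  move=> X1s Y1s; have := lc_torsion Dbar_lc X1s Y1s.
  rewrite -(lc_torsion D_lc X1s Y1s) => /(congr1 (fun v => bil (g p) v (Z1 p))).
  by rewrite !bilDl !bilNl /t [bil _ (Y1 p) (X1 p)]g_sym => ?; lra.
have t_skew X1 Y1 Z1 : vsmooth_near p Y1 -> vsmooth_near p Z1 -> t X1 Y1 Z1 = - t X1 Z1 Y1.
  move=> Y1s Z1s; have := lc_metric Dbar_lc (X1 p) Y1s Z1s.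
  have -> : (fun q => bil (conformal u g q) (Y1 q) (Z1 q)) =
            (fun q => expR (2 * u q) * bil (g q) (Y1 q) (Z1 q)).
    by apply/funext => q; rewrite bil_scale.
  rewrite (dfun_exp_mul _ (u_smooth p) (metric_smooth gP Y1s Z1s)).
  rewrite (lc_metric D_lc (X1 p) Y1s Z1s) !bil_scale -mulrDr.
  (* Differentiating the factor e^(2u) leaves 2 du(X) g(Y,Z), which the du(X) terms of [t X1 Y1 Z1]
     and [t X1 Z1 Y1] absorb in equal halves. *)
  move=> /(mulfI (lt0r_neq0 (expR_gt0 _))).
  rewrite /t [bil _ (D p _ Z1) _]g_sym [bil _ (Dbar p _ Z1) _]g_sym.
  by rewrite [bil _ (Z1 p) (Y1 p)]g_sym => ?; lra.
(* Alternating the two symmetries: t(X,Y,Z) = -t(X,Z,Y) = -t(Z,X,Y) = t(Z,Y,X) = t(Y,Z,X) =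
   -t(Y,X,Z) = -t(X,Y,Z). *)
have t0 : t X Y Z = 0.
  have e1 := t_skew X Y Z Ys Zs; have e2 := t_sym X Z Y Xs Zs.
  have e3 := t_skew Z X Y Xs Ys; have e4 := t_sym Z Y X Zs Ys.
  have e5 := t_skew Y Z X Zs Xs; have e6 := t_sym Y X Z Ys Xs.
  clearbody t; lra.
by move: t0; rewrite /t bilDl !bilDl bilNl !bilZl bil_grad => ?; lra.
Qed.

End ConformalLeviCivita.

(** * Conformal change of F, the Lie form and the Lie vector *)

Section ConformalLieForm.
Variables (R : realType) (n : nat) (M : manifold R n.*2).
Variables (J g : tensor2 M) (u : M -> R) (D Dbar : covder M).
Variables (theta thetabar : form1 M) (Omega Omegabar : vfield M).
Hypothesis nJg : norden J g.
Hypothesis u_smooth : forall p, smooth_near p u.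
Hypothesis D_lc : levi_civita g D.
Hypothesis Dbar_lc : levi_civita (conformal u g) Dbar.
Hypothesis thetaE : lie_form J g D theta.
Hypothesis thetabarE : lie_form J (conformal u g) Dbar thetabar.
Hypothesis OmegaE : lie_vector g theta Omega.
Hypothesis OmegabarE : lie_vector (conformal u g) thetabar Omegabar.

Let gP : pseudo_riemannian g := norden_metric nJg.
Let JJ : almost_complex J := norden_acs nJg.
Let du p := dfun u p.
Let grad p := raise (g p) (dfun u p).

(** The summand du(x) y of the change of connection commutes with J and drops out; the other two
    survive, with J moved onto [z] by self-adjointness. *)
Lemma conformal_Ftensor p x Y z : vsmooth_near p Y ->
  Ftensor J (conformal u g) Dbar p x Y z = expR (2 * u p) *
    (Ftensor J g D p x Y z + du p (Y p *m J p) * bil (g p) x z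
     - bil (g p) x (Y p *m J p) * du p z - du p (Y p) * bil (g p) x (z *m J p)
     + bil (g p) x (Y p) * du p (z *m J p)).
Proof.
move=> Ys; have JYs := acs_smooth JJ Ys.
rewrite /Ftensor bil_scale; congr (_ * _).
rewrite !(conformal_levi_civita gP u_smooth D_lc Dbar_lc) // /applyf.
rewrite !(mulmxDl, mulNmx) -!scalemxAl !(bilDl, bilNl, bilZl) !(norden_adjoint nJg).
rewrite !(bil_grad gP u_smooth) /du.
move: (bil _ _ _) (bil _ _ _) (bil _ _ _) (bil _ _ _) (bil _ _ _) => b1 b2 b3 b4 b5.
move: (dfun _ _ _) (dfun _ _ _) (dfun _ _ _) (dfun _ _ _) (dfun _ _ _) => d1 d2 d3 d4 d5; ring.
Qed.

Lemma conformal_lie_form p z :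
  thetabar p z = theta p z + (2 * n%:R) * du p (z *m J p).
Proof.
have gu := metric_nondegenerate gP p; have g_sym := Defs.metric_sym gP p.
have duL : linear (du p : _ -> R) by exact: dfun_linear.
have trJ : \tr (J p) = 0.
  apply: trace_complex_structure; apply/row_matrixP => i.
  by rewrite !rowE mulmxA (acs_sqr JJ) mulmxN mulmx1.
(* At [p] this frame is the standard basis, so its Gram matrix is the matrix of the metric
   itself. *)
pose e l := coord_field (M := M) (chart_at p) (delta_mx 0 l).
have ep l : e l p = delta_mx 0 l by exact/changeK/mem_chart_at.
have e_frame : local_frame p e := coord_frame (mem_chart_at p).
have [es _] := e_frame; have gramE (A : 'M[R]_n.*2) : \matrix_(k, l) bil A (e k p) (e l p) = A.
  by apply/matrixP => k l; rewrite mxE !ep bil_delta -rowE mxE.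
have x0 : expR (2 * u p) != 0 by rewrite gt_eqF // expR_gt0.
rewrite (thetabarE e_frame) (thetaE e_frame) !gramE /conformal invmxZ; last first.
  by rewrite unitmxZ // unitfE.
have duJL : linear ((fun x => du p (x *m J p)) : _ -> R).
  by move=> k x y; rewrite mulmxDl -scalemxAl duL.
have S1 := contract_linear z gu g_sym duJL.
have S2 := contract_comp (J p) gu g_sym.
have S3 := contract_linear (z *m J p) gu g_sym duL.
have S4 := contract_comp 1%:M gu g_sym.
rewrite trJ in S2; rewrite mxtrace1 in S4.
(* The factor e^(2u) of F cancels against the inverse of the conformal metric. Of the four new
   terms, the first and third contract to opposite values du(Jz), the second carries tr J = 0, and
   the last carries tr 1 = 2n, the constant of the result. *)
transitivity (\sum_i \sum_j
  (invmx (g p) i j * Ftensor J g D p (e i p) (e j) z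
   + invmx (g p) i j * (du p (delta_mx 0 j *m J p) * bil (g p) (delta_mx 0 i) z)
   - invmx (g p) i j * bil (g p) (delta_mx 0 i) (delta_mx 0 j *m J p) * du p z
   - invmx (g p) i j * (du p (delta_mx 0 j) * bil (g p) (delta_mx 0 i) (z *m J p))
   + invmx (g p) i j * bil (g p) (delta_mx 0 i) (delta_mx 0 j *m 1%:M) * du p (z *m J p))).
  apply: eq_bigr => i _; apply: eq_bigr => j _.
  rewrite mxE conformal_Ftensor // !ep mulmx1.
  rewrite mulrACA mulVf // mul1r.
  move: (bil _ _ _) (bil _ _ _) (bil _ _ _) (bil _ _ _) (Ftensor _ _ _ _ _ _ _) => b1 b2 b3 b4 f.
  move: (invmx _ _ _) (du _ _) (du _ _) (du _ _) (du _ _) => v d1 d2 d3 d4; ring.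
under eq_bigr do rewrite !big_split /= !sumrN -!mulr_suml.
rewrite !big_split /= !sumrN -!mulr_suml S1 S2 S3 S4 mul0r subr0.
have n2 : n.*2%:R = 2 * n%:R :> R by rewrite -mul2n natrM.
by rewrite addrK n2.
Qed.

Lemma conformal_lie_vector p :
  Omegabar p = expR (- (2 * u p)) *: (Omega p + (2 * n%:R) *: (grad p *m J p)).
Proof.
have gu := metric_nondegenerate gP p; have g_sym := Defs.metric_sym gP p.
apply: (bil_nondegenerate gu) => x; rewrite g_sym; apply: (mulfI (lt0r_neq0 (expR_gt0 (2 * u p)))).
rewrite -bil_scale -[LHS]OmegabarE conformal_lie_form.
rewrite bilZl mulrA -expRD subrr expR0 mul1r bilDl bilZl.
by rewrite (norden_adjoint nJg) (bil_grad gP u_smooth) g_sym -OmegaE.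
Qed.

End ConformalLieForm.

(** Because J^2 = -1, the term theta(Jy) x / 2n changes by -du(y) x and -g(x,y) J Omega / 2n by
    +g(x,y) grad u, which removes the corresponding terms of the Levi-Civita change. The same sign
    turns the [l3] and [l4] terms into multiples of -2 du(x). *)
Lemma conformal_nabla' (R : realType) (n : nat) (M : manifold R n.*2)
    (J g : tensor2 M) (u : M -> R) (D Dbar : covder M)
    (theta thetabar : form1 M) (Omega Omegabar : vfield M) (l1 l2 l3 l4 : R) p x Y :
  (0 < n)%N -> norden J g -> (forall p, smooth_near p u) ->
  levi_civita g D -> levi_civita (conformal u g) Dbar ->
  lie_form J g D theta -> lie_form J (conformal u g) Dbar thetabar ->
  lie_vector g theta Omega -> lie_vector (conformal u g) thetabar Omegabar ->
  vsmooth_near p Y ->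
  nabla' J (conformal u g) Dbar thetabar Omegabar l1 l2 l3 l4 p x Y =
  nabla' J g D theta Omega l1 l2 l3 l4 p x Y
  + (((1 - 2 * l3) * dfun u p x + 2 * l1 * dfun u p (x *m J p)) *: Y p
     + (- (2 * l4) * dfun u p x + 2 * l2 * dfun u p (x *m J p)) *: (Y p *m J p)).
Proof.
move=> n0 nJg us D_lc Dbar_lc thE thbE OmE OmbE Ys.
have n_neq0 : n%:R != 0 :> R by rewrite pnatr_eq0 -lt0n.
have JJ := acs_sqr (norden_acs nJg).
have thb := conformal_lie_form nJg us D_lc Dbar_lc thE thbE.
have duL := dfun_linear (us p).
have duN v : dfun u p (- v) = - dfun u p v.
  have du0 : dfun u p 0 = 0.
    by have := duL (-1) 0 0; rewrite scaler0 addr0 => ->; rewrite scaleN1r addNr.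
  by have := duL (-1) v 0; rewrite scaleN1r !addr0 du0 addr0 scaleN1r.
rewrite /nabla' (conformal_levi_civita (norden_metric nJg) us D_lc Dbar_lc) //.
rewrite !thb (conformal_lie_vector nJg us D_lc Dbar_lc thE thbE OmE OmbE).
rewrite bil_scale !JJ !duN expRN -!scalemxAl mulmxDl -!scalemxAl JJ.
have e0 : expR (2 * u p) != 0 by rewrite gt_eqF // expR_gt0.
move: (expR _) e0 (raise _ _) (Omega p *m J p) (bil _ _ _) => e e0 gr OJ b.
move: (theta p _) (theta p _) (theta p _) => t1 t2 t3.
move: (dfun _ _ _) (dfun _ _ _) (dfun _ _ _) => d1 d2 d3.
move: (Y p *m J p) (Y p) (D p x Y) n%:R n_neq0 => yJ y DY N N0.
by apply/rowP => l; rewrite !mxE; field; rewrite N0 e0.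
Qed.

Theorem corollary4p1 (R : realType) (n : nat) (n_gt0 : (0 < n)%N)
    (M : manifold R n.*2) (J g : tensor2 M)
    (D : covder M) (theta : form1 M) (Omega : vfield M)
    (l1 l2 l3 l4 : R) (u : M -> R)
    (Dbar : covder M) (thetabar : form1 M) (Omegabar : vfield M) :
  let gbar := conformal u g in
  norden J g ->
  levi_civita g D ->
  lie_form J g D theta ->
  lie_vector g theta Omega ->
  conformal_kaehler J g D theta ->
  pluriharmonic J u ->
  levi_civita gbar Dbar ->
  lie_form J gbar Dbar thetabar ->
  lie_vector gbar thetabar Omegabar ->
  forall (p : M) (X Y Z W : vfield M),
    vsmooth_near p X -> vsmooth_near p Y ->
    vsmooth_near p Z -> vsmooth_near p W ->
    curvature4 gbar (nabla' J gbar Dbar thetabar Omegabar l1 l2 l3 l4) p X Y Z W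
    = expR (2 * u p)
      * curvature4 g (nabla' J g D theta Omega l1 l2 l3 l4) p X Y Z W.
Proof.
move=> gbar nJg D_lc thE OmE [w1 _ _] [u_sm duJ0] Dbar_lc thbE OmbE p X Y Z W Xs Ys Zs Ws.
have us q : smooth_near q u by exists setT; split=> //; exact: openT.
have JJ := norden_acs nJg; have gP := norden_metric nJg.
have Dc := lc_connection D_lc.
have th_smooth q V : vsmooth_near q V -> smooth_near q (fun r => theta r (V r)).
  exact: lie_form_smooth JJ gP Dc thE.
have du_smooth q V : vsmooth_near q V -> smooth_near q (fun r => dfun u r (V r)).
  exact: dfun_smooth (us q).
have duJ_smooth q V : vsmooth_near q V ->
    smooth_near q (fun r => form_comp (dfun u) J r (V r)).
  by move=> Vs; exact: dfun_smooth (us q) (acs_smooth JJ Vs).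
(* Both gauge forms belong to this family, so smoothness and closedness are settled once: du is
   exact, and du o J is closed by pluriharmonicity. *)
pose w (c1 c2 : R) : form1 M := fun q x => c1 * dfun u q x + c2 * form_comp (dfun u) J q x.
have w_smooth c1 c2 q V : vsmooth_near q V -> smooth_near q (fun r => w c1 c2 r (V r)).
  move=> Vs; apply: smooth_near_add.
    by apply: smooth_near_mul (du_smooth q V Vs); exact: smooth_near_cst.
  by apply: smooth_near_mul (duJ_smooth q V Vs); exact: smooth_near_cst.
have w_closed c1 c2 : dform (w c1 c2) p X Y = 0.
  rewrite (dform_combination _ _ Xs Ys (du_smooth p) (duJ_smooth p)).
  by rewrite (dform_dfun (us p) Xs Ys) (duJ0 p X Y Xs Ys) !mulr0 addr0.
have RE : curvature (nabla' J gbar Dbar thetabar Omegabar l1 l2 l3 l4) p X Y Z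
    = curvature (nabla' J g D theta Omega l1 l2 l3 l4) p X Y Z.
  apply: (gauge_curvature JJ (nabla'_connection l1 l2 l3 l4 nJg Dc OmE th_smooth) _ _
    (w_smooth (1 - 2 * l3) (2 * l1)) (w_smooth (- (2 * l4)) (2 * l2))) => //.
  - by move=> q x V Vs; exact: nabla'_complex.
  - by move=> q x V Vs; exact: conformal_nabla'.
(* The (1,3) curvatures agree, so the factor e^(2u) comes only from lowering the index with the
   conformal metric. *)
by rewrite /curvature4 RE bil_scale.
Qed.
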